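(* Let $d\ge 1$ and let $\Phi(N,n)=\left(\sum_{k=-\infty}^{+\infty}\Psi(N^{-1}k)\right)^{-1}\Psi(N^{-1}n)$ for integers $N\ge 1$ and $n\in\mathbb Z$, with $\Psi:\mathbb R\to\mathbb C$ a smooth compactly supported bounded function such that, for some constants $C_1,C_2>0$, $C_1N\le\left|\sum_{n=-\infty}^{+\infty}\Psi(N^{-1}n)\right|\le C_2N$ for every $N\ge1$. Let $\alpha$ be an irrational vector in $\mathbb R^d$ and assume that there exist constants $H>0$ and $\sigma\ge d$ such that $\|\alpha\cdot m\|\ge H|m|^{-\sigma}$ for every $m\in\mathbb Z^d\setminus\{0\}$. Assume that $\delta>d/2$ and set $$Y(d,\delta,\sigma,N)=\begin{cases}N^{\frac{d}{\sigma-d}\left(\frac12-\frac{\delta}{\sigma}\right)}&\text{if }\delta/\sigma<1/2,\\ \log(1+N)&\text{if }\delta/\sigma=1/2,\\ \log^{1/2}(1+N)&\text{if }\delta/\sigma>1/2.\end{cases}$$ Then there exists a positive constant $c$ such that for every $f\in W^{\delta,2}(\mathbb T^d)$ and every positive integer $N$, $$\sup_{x\in\mathbb T^d}\left|\mathcal D_N^{\Phi,\alpha}f(x)\right|\le c\,\|f\|_{\delta,2}\,N^{-\frac{\delta}{\sigma}}\,Y(d,\delta,\sigma,N).$$ When $\sigma=d$ the speed of convergence $cN^{-\frac{\delta}{d}}$ cannot be improved, in the sense that there exists $c>0$ such that for every positive integer $N$, every distribution of points $\{z(n)\}_{n=1}^N$ in $\mathbb T^d$ and every choice of weights $\{\omega(n)\}_{n=1}^N$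 there exist nonconstant functions $f\in W^{\delta,2}(\mathbb T^d)$ with $$\left|\sum_{n=1}^N\omega(n)f(z(n))-\int_{\mathbb T^d}f(y)\,dy\right|\ge cN^{-\frac{\delta}{d}}\|f\|_{\delta,2}.$$
   Context: $\mathbb T^d=\mathbb R^d/\mathbb Z^d$; functions on $\mathbb T^d$ are identified with $\mathbb Z^d$-periodic functions on $\mathbb R^d$. For real $t$, $\|t\|=\inf_{n\in\mathbb Z}|t-n|$. A vector $\alpha=(\alpha_1,\dots,\alpha_d)\in\mathbb R^d$ is irrational if $1,\alpha_1,\dots,\alpha_d$ are linearly independent over $\mathbb Q$. Fourier coefficients: $\widehat f(m)=\int_{\mathbb T^d}f(x)e^{-2\pi i m\cdot x}dx$. For $\delta>0$, $W^{\delta,2}(\mathbb T^d)$ is the space of distributions on $\mathbb T^d$ with $\|f\|_{\delta,2}=\left(\sum_{m\in\mathbb Z^d}(1+|m|^2)^\delta|\widehat f(m)|^2\right)^{1/2}<\infty$; when $\delta>d/2$ its elements are identified with their continuous representatives. The weighted discrepancy is $\mathcal D_N^{\Phi,\alpha}f(x)=\sum_{n=-\infty}^{+\infty}\Phi(N,n)f(x+n\alpha)-\int_{\mathbb T^d}f(y)\,dy$. Weights $\omega(n)$ are arbitrary complex numbers. *)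

(* Defs.v *)
From mathcomp Require Import all_boot all_order all_algebra.
From mathcomp Require Import all_classical all_reals all_analysis.
From mathcomp Require Export complex.
Set Implicit Arguments.
Unset Strict Implicit.
Unset Printing Implicit Defensive.
Import Order.TTheory GRing.Theory Num.Theory.
Import numFieldNormedType.Exports.
Local Open Scope classical_set_scope.
Local Open Scope ring_scope.
Local Open Scope complex_scope.

(* The modulus of z : R[i] is Normc.normc z : R; the generic `|z| lives in
   R[i]. *)
Notation normc := Normc.normc.

Section RealDefs.
Variable R : realType.

(* Functions on the torus R^d / Z^d are Z^d-periodic functions on 'rV[R]_d. *)

Definition zvec (d : nat) (m : 'rV[int]_d) : 'rV[R]_d := map_mx intr m.

Definition dot (d : nat) (x y : 'rV[R]_d) : R := \sum_(i < d) x 0 i * y 0 i.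

(* The norm `|x| of the library on 'rV[R]_d is the sup norm, whence: *)
Definition enorm (d : nat) (x : 'rV[R]_d) : R := Num.sqrt (dot x x).

Definition dist_int (t : R) : R := inf [set `|t - n%:~R| | n in [set: int]].

Definition irrational_vector (d : nat) (alpha : 'rV[R]_d) : Prop :=
  forall (q0 : rat) (q : 'I_d -> rat),
    ratr q0 + \sum_(i < d) ratr (q i) * alpha 0 i = 0 ->
    q0 = 0 /\ forall i, q i = 0.

(* R[i] has no topological structure in the library: smoothness and continuity
   of complex-valued functions are those of the real and imaginary parts. *)

Definition smooth (f : R -> R) : Prop :=
  forall (n : nat) (x : R), derivable (derive1n n f) x 1.

Definition smoothC (f : R -> R[i]) : Prop :=
  smooth (fun t => complex.Re (f t)) /\ smooth (fun t => complex.Im (f t)).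

Definition compactly_supported (f : R -> R[i]) : Prop :=
  compact (closure [set t | f t != 0]).

Definition boundedC (f : R -> R[i]) : Prop :=
  exists M : R, forall t, normc (f t) <= M.

(* Iterated Lebesgue integral over [0, 1]^d. It is only used on continuous
   integrands, for which it is the d-dimensional Lebesgue integral (Fubini). *)
Fixpoint cube_integral (d : nat) : ('rV[R]_d -> R) -> R :=
  match d with
  | 0 => fun g => g 0
  | d'.+1 => fun g =>
      \int[@lebesgue_measure R]_(t in `[0, 1])
        cube_integral (fun y : 'rV[R]_d' => g (row_mx (t%:M : 'rV[R]_1) y))
  end.

Definition torus_integral (d : nat) (f : 'rV[R]_d -> R[i]) : R[i] :=
  cube_integral (fun x => complex.Re (f x)) +i*
  cube_integral (fun x => complex.Im (f x)).

Definition cis (t : R) : R[i] := cos t +i* sin t.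

Definition fourier (d : nat) (f : 'rV[R]_d -> R[i]) (m : 'rV[int]_d) : R[i] :=
  torus_integral (fun x => f x * cis (- (2 * pi * dot (zvec m) x))).

Definition periodic (d : nat) (f : 'rV[R]_d -> R[i]) : Prop :=
  forall (x : 'rV[R]_d) (m : 'rV[int]_d), f (x + zvec m) = f x.

Definition sobolev_sqnorm (d : nat) (delta : R) (f : 'rV[R]_d -> R[i]) :
    \bar R :=
  (\esum_(m in [set: 'rV[int]_d])
    ((1 + enorm (zvec m) ^+ 2) `^ delta * normc (fourier f m) ^+ 2)%:E)%E.

Definition sobolev_norm (d : nat) (delta : R) (f : 'rV[R]_d -> R[i]) : R :=
  Num.sqrt (fine (sobolev_sqnorm delta f)).

Definition continuousC (d : nat) (f : 'rV[R]_d -> R[i]) : Prop :=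
  continuous (fun x => complex.Re (f x)) /\
  continuous (fun x => complex.Im (f x)).

(* W^{delta,2}(T^d) for delta > d/2: each such distribution is identified with
   its continuous representative, so the elements are continuous functions. *)
Definition sobolev (d : nat) (delta : R) (f : 'rV[R]_d -> R[i]) : Prop :=
  [/\ continuousC f, periodic f & (sobolev_sqnorm delta f < +oo)%E].

(* The sums over the integers below are the library's finitely supported sums
   (0 if the support is infinite); with a compactly supported Psi and N > 0
   only finitely many terms are nonzero. *)

Definition sample_sum (Psi : R -> R[i]) (N : nat) : R[i] :=
  \sum_(k \in [set: int]) Psi (N%:R^-1 * k%:~R).

Definition Phi_of (Psi : R -> R[i]) (N : nat) (n : int) : R[i] :=
  (sample_sum Psi N)^-1 * Psi (N%:R^-1 * n%:~R).

Definition discrepancy (d : nat) (Phi : nat -> int -> R[i])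
    (alpha : 'rV[R]_d) (N : nat) (f : 'rV[R]_d -> R[i]) (x : 'rV[R]_d) :
    R[i] :=
  \sum_(n \in [set: int]) (Phi N n * f (x + n%:~R *: alpha)) -
  torus_integral f.

Definition Y (d : nat) (delta sigma : R) (N : nat) : R :=
  if delta / sigma < 1 / 2 then
    N%:R `^ (d%:R / (sigma - d%:R) * (1 / 2 - delta / sigma))
  else if delta / sigma == 1 / 2 then ln (1 + N%:R)
  else ln (1 + N%:R) `^ (1 / 2).

End RealDefs.

(* Main.v *)
(* Upper bound.  For a trigonometric polynomial the discrepancy is the sum over
   [m <> 0] of [fhat m * e(m x) * Phihat_N(m alpha)], so by Cauchy-Schwarz it is
   at most [||f||_delta] times the square root of the sum over [m <> 0] of
   [(1+|m|^2)^(-delta) |Phihat_N(m alpha)|^2].  Fejer means extend this to every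
   [f] without summing its Fourier series.  Summation by parts [k] times gives
   [|Phihat_N(t)| <= C min(1, (N ||t||)^(-k))].  For [|m| < 2^(j+1)] the points
   [m alpha] are [c 2^(-j sigma)]-separated modulo 1, so with
   [u = 2^(j sigma) / N] the dyadic block [|m| ~ 2^j] contributes at most
   [C 2^(-2 delta j) min(u^(2k), u, 2^(j d))]; these terms peak geometrically in
   [j], or form a plateau of [O(log N)] equal terms when [2 delta = sigma].

   Lower bound.  Among the [D = L^d >= 2N] trigonometric monomials with
   frequencies in [[0, L)^d], at least [D - N] orthonormal combinations [g_a]
   vanish at all nodes.  The function [sum_a |g_a|^2] vanishes at the nodes, has
   mean [D - N >= D/2], is at most [D] by Bessel's inequality in [C^D], and has
   degree at most [L ~ N^(1/d)], so its Sobolev norm is [O(N^(delta/d) D)]. *)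

(* The constants must not depend on [f] or [N]. Every estimate is therefore made for an arbitrary
   finite injective family of frequencies, with a constant blind to the family. A Fejer mean is the
   average over [b] of sums over the families [a - b], each injective in [a], so it inherits the
   bound without loss. The error of this approximation may depend badly on [N], since it is sent to
   0 with [N] fixed. The form of [Y] records where the blocks peak. If sigma > 2 delta, the bounds u
   and 2^(j d) cross at 2^j = N^(1/(sigma - d)), where u > 1, and the value there is the power of
   [N]. If sigma < 2 delta, the peak is at u = 1, and it is below it that the decay of order k >= 2
   delta / sigma is needed. In the lower bound a single |g_a|^2 would have mean 1 and a supremum
   controlled only by D. Summing over [a] makes the mean comparable to the bound on the supremum, so
   that replacing the L2 norm by the supremum costs only a constant. *)
Require Import Defs.
From mathcomp Require Import all_boot all_order all_algebra.
From mathcomp Require Import all_classical all_reals all_analysis.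
From mathcomp Require Import ring lra zify.
Import Order.TTheory GRing.Theory Num.Theory.
Import numFieldNormedType.Exports.
Local Open Scope classical_set_scope.
Local Open Scope ring_scope.
Local Open Scope complex_scope.

(** * The iterated integral on bounded uniformly continuous functions *)

Section CubeIntegral.
Set Implicit Arguments.
Unset Strict Implicit.
Unset Printing Implicit Defensive.
Variable R : realType.
Implicit Types (d : nat).

(** A class of integrands stable under sums, products and freezing a coordinate. The modulus refers
    to the coordinatewise sup distance, which freezing respects, so that partial integrals keep the
    modulus of the integrand. *)
Definition buc d (g : 'rV[R]_d -> R) : Prop :=
  (exists M, forall x, `|g x| <= M) /\
  (forall e, 0 < e -> exists2 h, 0 < h &
     forall x y : 'rV[R]_d, (forall i, `|x 0 i - y 0 i| <= h) ->
       `|g x - g y| <= e).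

Lemma buc_cst d c : buc (fun _ : 'rV[R]_d => c).
Proof.
split; first by exists `|c|.
by move=> e e0; exists 1 => // x y _; rewrite subrr normr0 ltW.
Qed.

Lemma bucD d (g h : 'rV[R]_d -> R) : buc g -> buc h ->
  buc (fun x => g x + h x).
Proof.
move=> [[M gM] gu] [[K hK] hu]; split.
  exists (M + K) => x; apply: le_trans (ler_normD _ _) _.
  by apply: lerD.
move=> e e0; have e20 : 0 < e / 2 by lra.
have [a a0 ga] := gu _ e20; have [b b0 hb] := hu _ e20.
exists (Num.min a b); first by rewrite lt_min a0 b0.
move=> x y xy.
have -> : g x + h x - (g y + h y) = (g x - g y) + (h x - h y) by ring.
apply: le_trans (ler_normD _ _) _.
have -> : e = e / 2 + e / 2 by lra.
by apply: lerD; [apply: ga|apply: hb] => i; apply: le_trans (xy i) _;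
  rewrite ge_min lexx ?orbT.
Qed.

Lemma bucM d (g h : 'rV[R]_d -> R) : buc g -> buc h ->
  buc (fun x => g x * h x).
Proof.
move=> [[M gM] gu] [[K hK] hu]; split.
  exists (M * K) => x; rewrite normrM.
  by apply: ler_pM.
move=> e e0.
have M0 : 0 <= M by apply: le_trans (normr_ge0 _) (gM 0).
have K0 : 0 <= K by apply: le_trans (normr_ge0 _) (hK 0).
pose B := M + K + 1; have B0 : 0 < B by rewrite /B; lra.
have eB0 : 0 < e / (2 * B) by rewrite divr_gt0 // mulr_gt0.
have [a a0 ga] := gu _ eB0; have [b b0 hb] := hu _ eB0.
exists (Num.min a b); first by rewrite lt_min a0 b0.
move=> x y xy.
have -> : g x * h x - g y * h y = (g x - g y) * h x + g y * (h x - h y) by ring.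
apply: le_trans (ler_normD _ _) _; rewrite !normrM.
have -> : e = e / (2 * B) * B + B * (e / (2 * B)).
  by field; apply/eqP; lra.
apply: lerD; apply: ler_pM => //.
- by apply: ga => i; apply: le_trans (xy i) _; rewrite ge_min lexx.
- by apply: le_trans (hK _) _; rewrite /B; lra.
- by apply: le_trans (gM _) _; rewrite /B; lra.
- by apply: hb => i; apply: le_trans (xy i) _; rewrite ge_min lexx orbT.
Qed.

Lemma bucZ d c (g : 'rV[R]_d -> R) : buc g -> buc (fun x => c * g x).
Proof. by apply: bucM; exact: buc_cst. Qed.

Lemma bucN d (g : 'rV[R]_d -> R) : buc g -> buc (fun x => - g x).
Proof.
move=> /(bucZ (-1)); congr buc; apply/funext => x.
by rewrite mulN1r.
Qed.

Lemma buc_sum d (I : Type) (r : seq I) (P : pred I) (F : I -> 'rV[R]_d -> R) :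
  (forall i, buc (F i)) -> buc (fun x => \sum_(i <- r | P i) F i x).
Proof.
move=> bF; elim: r => [|i r IH].
  have := @buc_cst d 0; congr buc; apply/funext => x.
  by rewrite big_nil.
case Pi: (P i).
  have := bucD (bF i) IH; congr buc; apply/funext => x.
  by rewrite big_cons Pi.
by move: IH; congr buc; apply/funext => x; rewrite big_cons Pi.
Qed.

Lemma ler_dist_cos (a b : R) : `|cos a - cos b| <= `|a - b|.
Proof.
wlog ab : a b / a < b => [hw|].
  have [|/hw //|->] := ltgtP a b; first exact: hw.
    by rewrite distrC (distrC a); apply.
  by rewrite !subrr.
have dc (x : R) : x \in `]a, b[ -> is_derive x 1 cos (- sin x).
  by move=> _; exact: is_derive_cos.
have [|c _ E] := MVT ab dc.
  by apply: continuous_subspaceT => x; apply: continuous_cos.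
rewrite distrC E normrM normrN (distrC a).
rewrite -[leRHS]mul1r ler_wpM2r // ler_norml.
by rewrite sin_geN1 sin_le1.
Qed.

Lemma buc_cos d (v : 'rV[R]_d) (p : R) : buc (fun x => cos (dot v x + p)).
Proof.
split.
  by exists 1 => x; rewrite ler_norml cos_geN1 cos_le1.
move=> e e0; pose S := \sum_i `|v 0 i| + 1.
have S0 : 0 < S by apply: ltr_wpDl => //; apply: sumr_ge0.
exists (e / S); first exact: divr_gt0.
move=> x y xy; apply: le_trans (ler_dist_cos _ _) _.
have -> : dot v x + p - (dot v y + p) = \sum_i v 0 i * (x 0 i - y 0 i).
  rewrite /dot opprD addrACA subrr addr0 -sumrB.
  by apply: eq_bigr => i _; rewrite mulrBr.
apply: le_trans (ler_norm_sum _ _ _) _.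
apply: (@le_trans _ _ (\sum_i `|v 0 i| * (e / S))).
  by apply: ler_sum => i _; rewrite normrM ler_wpM2l.
rewrite -mulr_suml mulrCA ger_pMr // ler_pdivrMr // mul1r.
by rewrite /S lerDl.
Qed.

Definition cons_rv d (t : R) (y : 'rV[R]_d) : 'rV[R]_d.+1 :=
  row_mx (t%:M : 'rV[R]_1) y.

Lemma cons_rv_dist d (s t : R) (x y : 'rV[R]_d) (h : R) :
  `|s - t| <= h -> (forall i, `|x 0 i - y 0 i| <= h) ->
  forall i, `|cons_rv s x 0 i - cons_rv t y 0 i| <= h.
Proof.
move=> st xy i; rewrite /cons_rv.
case: (@split_ordP 1 d i) => j -> /=.
  rewrite !(@row_mxEl _ _ 1 d) !mxE.
  by rewrite ord1 eqxx !mulr1n.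
by rewrite !(@row_mxEr _ _ 1 d).
Qed.

Lemma buc_cons d (g : 'rV[R]_d.+1 -> R) t : buc g ->
  buc (fun y => g (cons_rv t y)).
Proof.
move=> [[M gM] gu]; split; first by exists M.
move=> e /gu[h h0 H]; exists h => // x y xy.
by apply/H/cons_rv_dist => //; rewrite subrr normr0 ltW.
Qed.

Definition unif_cont1 (u : R -> R) := forall e, 0 < e -> exists2 h, 0 < h &
  forall s t, `|s - t| <= h -> `|u s - u t| <= e.

Lemma unif_cont1_continuous (u : R -> R) : unif_cont1 u -> continuous u.
Proof.
move=> uu x; apply/cvgrPdist_le => e /uu[h h0 H].
near=> y; apply: H; near: y.
by apply/cvgrPdist_le: h h0 => //.
Unshelve. all: by end_near. Qed.

Lemma unif_cont1_integrable (u : R -> R) : unif_cont1 u ->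
  (@lebesgue_measure R).-integrable `[0, 1] (EFin \o u).
Proof.
move=> /unif_cont1_continuous cu.
apply: continuous_compact_integrable; first exact: segment_compact.
exact: continuous_subspaceT.
Qed.

Lemma Rintegral01_cst (c : R) :
  \int[@lebesgue_measure R]_(t in `[0, 1]) c = c.
Proof.
rewrite Rintegral_cst; last exact: measurable_itv.
by have /= -> := @lebesgue_measure_itv R `[0, 1]; rewrite lte_fin ltr01 oppr0 adde0 mulr1.
Qed.

(** The four laws need a joint induction: in dimension [d.+1] the inner integral has to be
    integrable in the first coordinate, which follows from its uniform continuity, and this uses
    order, addition and constants in dimension [d]. *)
Lemma cube_integral_spec d :
  [/\ forall g h : 'rV[R]_d -> R, buc g -> buc h -> (forall x, g x <= h x) ->
        cube_integral g <= cube_integral h,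
      forall g h : 'rV[R]_d -> R, buc g -> buc h ->
        cube_integral (fun x => g x + h x) = cube_integral g + cube_integral h,
      forall c (g : 'rV[R]_d -> R), buc g ->
        cube_integral (fun x => c * g x) = c * cube_integral g &
      forall c, cube_integral (fun _ : 'rV[R]_d => c) = c].
Proof.
elim: d => [|d [IHle IHD IHZ IHc]]; first by split=> //= *; auto.
have mD : measurable (`[0, 1]%classic : set R) by exact: measurable_itv.
have uc (g : 'rV[R]_d.+1 -> R) : buc g ->
    unif_cont1 (fun t => cube_integral (fun y => g (cons_rv t y))).
  move=> bg; have [_ gu] := bg => e /gu[h h0 H]; exists h => // s t st.
  (* One side only; the other follows by exchanging [u] and [v]. *)
  have key u v : `|u - v| <= h -> cube_integral (fun y => g (cons_rv u y)) <=
      cube_integral (fun y => g (cons_rv v y)) + e.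
    move=> uv; rewrite -[X in _ + X](IHc e) -IHD; last 2 first.
    - exact: buc_cons.
    - exact: buc_cst.
    apply: IHle; first exact: buc_cons.
      by apply: bucD; [exact: buc_cons|exact: buc_cst].
    move=> x; rewrite -lerBlDl; apply: le_trans (ler_norm _) _.
    by apply/H/cons_rv_dist => // i; rewrite subrr normr0 ltW.
  rewrite ler_norml lerBlDl key // andbT lerNl opprB lerBlDl key //.
  by rewrite distrC.
split=> /=.
- move=> g h bg bh gh; apply: le_Rintegral => //.
  + exact/unif_cont1_integrable/uc.
  + exact/unif_cont1_integrable/uc.
  + by move=> t _; apply: IHle => [||x]; [exact: buc_cons..|exact: gh].
- move=> g h bg bh; rewrite -RintegralD //; last 2 first.
  + exact/unif_cont1_integrable/uc.
  + exact/unif_cont1_integrable/uc.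
  by apply: eq_Rintegral => t _; rewrite -IHD //; exact: buc_cons.
- move=> c g bg; rewrite -RintegralZl //; last first.
    exact/unif_cont1_integrable/uc.
  by apply: eq_Rintegral => t _; rewrite -IHZ //; exact: buc_cons.
- move=> c; under eq_Rintegral do rewrite IHc.
  by rewrite Rintegral01_cst.
Qed.

Lemma le_cube_integral d (g h : 'rV[R]_d -> R) : buc g -> buc h ->
  (forall x, g x <= h x) -> cube_integral g <= cube_integral h.
Proof. by have [le _ _ _] := cube_integral_spec d; exact: le. Qed.

Lemma cube_integralD d (g h : 'rV[R]_d -> R) : buc g -> buc h ->
  cube_integral (fun x => g x + h x) = cube_integral g + cube_integral h.
Proof. by have [_ add _ _] := cube_integral_spec d; exact: add. Qed.

Lemma cube_integralZ d c (g : 'rV[R]_d -> R) : buc g ->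
  cube_integral (fun x => c * g x) = c * cube_integral g.
Proof. by have [_ _ scale _] := cube_integral_spec d; exact: scale. Qed.

Lemma cube_integral_cst d c : cube_integral (fun _ : 'rV[R]_d => c) = c.
Proof. by have [_ _ _ ->] := cube_integral_spec d. Qed.

Lemma cube_integral_sum d (I : Type) (r : seq I) (P : pred I)
    (F : I -> 'rV[R]_d -> R) : (forall i, buc (F i)) ->
  cube_integral (fun x => \sum_(i <- r | P i) F i x) =
  \sum_(i <- r | P i) cube_integral (F i).
Proof.
move=> bF; elim: r => [|i r IH].
  rewrite big_nil -[RHS](cube_integral_cst d); congr cube_integral.
  by apply/funext => x; rewrite big_nil.
rewrite big_cons -IH; case: ifP => Pi.
  rewrite -cube_integralD //; last exact: buc_sum.
  by congr cube_integral; apply/funext => x; rewrite big_cons Pi.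
by congr cube_integral; apply/funext => x; rewrite big_cons Pi.
Qed.

(** The free phase [p] absorbs the other coordinates in the multidimensional integral and, at
    [- (pi / 2)], covers the sine. *)
Lemma Rintegral_cos (k : int) (p : R) :
  \int[@lebesgue_measure R]_(t in `[0, 1]) cos (2 * pi * k%:~R * t + p) =
  (k == 0)%:R * cos p.
Proof.
have [->|k0] := eqVneq k 0.
  under eq_Rintegral do rewrite mulr0 mul0r add0r.
  by rewrite Rintegral01_cst mul1r.
rewrite mul0r; pose w : R := 2 * pi * k%:~R.
have w0 : w != 0.
  by rewrite !mulf_neq0 ?intr_eq0 // gt_eqF // pi_gt0.
pose F (t : R) := w^-1 * sin (w * t + p).
have dF (t : R) : is_derive t (1 : R) F (cos (w * t + p)).
  rewrite /F; apply: is_derive_eq.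
  by rewrite addr0 /GRing.scale /= mulr1; field.
rewrite /Rintegral (@continuous_FTC2 _ _ F) //=.
- rewrite /F mulr1 mulr0 add0r -mulrBr.
  rewrite (addrC w).
  have -> : p + w = p + k%:~R * pi *+ 2 by rewrite /w; ring.
  rewrite (_ : sin (p + k%:~R * pi *+ 2) = sin p) ?subrr ?mulr0 //.
  have nat_per (q : R) (n : nat) : sin (q + n%:R * pi *+ 2) = sin q.
    elim: n => [|n IH]; first by rewrite mul0r mul0rn addr0.
    rewrite -[RHS]IH -[RHS]sinD2pi -addrA; congr (sin (_ + _)).
    by rewrite mulrSr; ring.
  case: (intP k) => [|n|n]; rewrite ?mul0r ?mul0rn ?addr0 //.
    exact: nat_per n.+1.
  rewrite -[LHS](nat_per _ n.+1); congr sin.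
  by rewrite mulrNz pmulrn; ring.
- apply: continuous_subspaceT => x; apply: continuous_comp; last first.
    exact: continuous_cos.
  apply: cvgD; last exact: cvg_cst.
  by apply: cvgM; [exact: cvg_cst|exact: cvg_id].
- split=> [t _| |].
  + by have [] := dF t.
  + apply/cvg_at_right_filter/differentiable_continuous/derivable1_diffP.
    by have [] := dF 0.
  + apply/cvg_at_left_filter/differentiable_continuous/derivable1_diffP.
    by have [] := dF 1.
- move=> t _; by rewrite derive1E; have [_ ->] := dF t.
Qed.

Lemma cube_integral_cos d (m : 'rV[int]_d) (p : R) :
  cube_integral (fun x => cos (2 * pi * dot (zvec R m) x + p)) =
  (m == 0)%:R * cos p.
Proof.
elim: d m p => [|d IH] m p.
  by rewrite [m]thinmx0 eqxx mul1r /= /dot big_ord0 mulr0 add0r.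
rewrite /=; pose m0 := m 0 0; pose m' : 'rV_d := \row_i m 0 (lift 0 i).
have E t (y : 'rV[R]_d) : dot (zvec R m) (row_mx (t%:M : 'rV_1) y) =
    m0%:~R * t + dot (zvec R m') y.
  rewrite /dot big_ord_recl !mxE; congr (_ + _).
    by case: splitP => // j _; rewrite ord1 mxE eqxx mulr1n.
  apply: eq_bigr => i _; rewrite !mxE; congr (_ * _).
  case: splitP => [j|j /= /eqP]; first by rewrite ord1.
  by rewrite /bump /= eqSS => /eqP/ord_inj ->.
under eq_Rintegral => t _.
  under eq_fun do rewrite E mulrDr -addrA addrCA.
  rewrite IH mulrA; over.
rewrite RintegralZl //; last first.
  apply: continuous_compact_integrable; first exact: segment_compact.
  apply: continuous_subspaceT => x; apply: continuous_comp; last first.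
    exact: continuous_cos.
  apply: cvgD; last exact: cvg_cst.
  by apply: cvgM; [exact: cvg_cst|exact: cvg_id].
rewrite Rintegral_cos mulrA -natrM mulnb; congr ((nat_of_bool _)%:R * _).
apply/andP/eqP => [[/eqP m'0 /eqP m00]|m_0].
  apply/rowP => i; rewrite mxE; have [j ->|->] := unliftP 0 i; last exact: m00.
  by move/rowP: m'0 => /(_ j); rewrite !mxE.
by split; apply/eqP; [apply/rowP => i|]; rewrite /m0 ?mxE m_0 mxE.
Qed.

End CubeIntegral.

(** * Complex arithmetic, characters of the torus, Fourier coefficients and Bessel's inequality *)

Section TorusIntegral.
Variable R : realType.
Set Implicit Arguments.
Unset Strict Implicit.
Unset Printing Implicit Defensive.
Implicit Types (d : nat) (z w : R[i]).

Lemma ReD z w : complex.Re (z + w) = complex.Re z + complex.Re w.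
Proof. by case: z; case: w. Qed.

Lemma ImD z w : complex.Im (z + w) = complex.Im z + complex.Im w.
Proof. by case: z; case: w. Qed.

Lemma ReM z w : complex.Re (z * w) =
  complex.Re z * complex.Re w - complex.Im z * complex.Im w.
Proof. by case: z; case: w. Qed.

Lemma ImM z w : complex.Im (z * w) =
  complex.Re z * complex.Im w + complex.Im z * complex.Re w.
Proof. by case: z => ? ?; case: w => ? ? /=. Qed.

Lemma Re_sum (I : Type) (r : seq I) (P : pred I) (F : I -> R[i]) :
  complex.Re (\sum_(i <- r | P i) F i) = \sum_(i <- r | P i) complex.Re (F i).
Proof. by apply: (big_morph _ ReD). Qed.

Lemma Im_sum (I : Type) (r : seq I) (P : pred I) (F : I -> R[i]) :
  complex.Im (\sum_(i <- r | P i) F i) = \sum_(i <- r | P i) complex.Im (F i).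
Proof. by apply: (big_morph _ ImD). Qed.

Lemma complex_ext z w : complex.Re z = complex.Re w ->
  complex.Im z = complex.Im w -> z = w.
Proof. by case: z => ? ?; case: w => ? ? /= -> ->. Qed.

Lemma normc_ge0 z : 0 <= normc z.
Proof. by case: z => a b; exact: sqrtr_ge0. Qed.

Lemma sqr_normcE z : normc z ^+ 2 = complex.Re z ^+ 2 + complex.Im z ^+ 2.
Proof. by case: z => a b /=; rewrite sqr_sqrtr // addr_ge0 ?sqr_ge0. Qed.

Lemma sqr_normcC z : (normc z ^+ 2)%:C = z * z^*.
Proof.
rewrite sqr_normcE; case: z => a b /=; apply: complex_ext => /=; ring.
Qed.

Lemma conjc_mul_conj z w : (z * w^*)^* = w * z^*.
Proof. by case: z; case: w => *; apply: complex_ext => /=; ring. Qed.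

Lemma normc_real (a : R) : normc a%:C = `|a|.
Proof. by rewrite /= expr0n addr0 sqrtr_sqr. Qed.

Lemma normc_le_ReIm z : normc z <= `|complex.Re z| + `|complex.Im z|.
Proof.
rewrite -ler_sqr ?nnegrE ?normc_ge0 ?addr_ge0 // sqr_normcE sqrrD.
rewrite !real_normK ?num_real // -addrA lerD2l lerDr.
by rewrite mulrn_wge0 // mulr_ge0.
Qed.

Lemma ler_normc_sum (I : Type) (r : seq I) (P : pred I) (F : I -> R[i]) :
  normc (\sum_(i <- r | P i) F i) <= \sum_(i <- r | P i) normc (F i).
Proof.
elim/big_rec2: _ => [|i y x Pi xy]; first by rewrite Normc.normc0.
by apply: le_trans (le_normcD _ _) _; rewrite lerD2l.
Qed.

Lemma normc_expr z n : normc (z ^+ n) = normc z ^+ n.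
Proof.
elim: n => [|n IH]; first by rewrite !expr0 Normc.normc1.
by rewrite !exprS Normc.normcM IH.
Qed.

Lemma cisD (s t : R) : cis (s + t) = cis s * cis t.
Proof.
by apply: complex_ext; rewrite ?ReM ?ImM /= ?cosD ?sinD //; ring.
Qed.

Lemma cis0 : cis 0 = 1 :> R[i].
Proof. by rewrite /cis cos0 sin0. Qed.

Lemma normc_cis (t : R) : normc (cis t) = 1.
Proof. by rewrite /= cos2Dsin2 sqrtr1. Qed.

Lemma cisN (t : R) : cis (- t) = (cis t)^*.
Proof. by apply: complex_ext; rewrite /= ?cosN ?sinN. Qed.

Lemma cis_2pi_nat (n : nat) : cis (2 * pi * n%:R) = 1 :> R[i].
Proof.
elim: n => [|n IH]; first by rewrite mulr0 cis0.
have -> : 2 * pi * n.+1%:R = 2 * pi * n%:R + 2 * pi :> R.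
  by rewrite -[n.+1%:R]natr1 mulrDr mulr1.
rewrite cisD IH mul1r; apply: complex_ext => /=.
  by rewrite mulr_natl cos2pi.
by rewrite mulr_natl sin2pi.
Qed.

Lemma cis_2pi_int (k : int) : cis (2 * pi * k%:~R) = 1 :> R[i].
Proof.
case: (intP k) => [|n|n]; rewrite ?mulr0 ?cis0 //; first exact: cis_2pi_nat.
by rewrite mulrNz mulrN cisN (cis_2pi_nat n.+1) conjc1.
Qed.

Definition chr d (m : 'rV[int]_d) (x : 'rV[R]_d) : R[i] :=
  cis (2 * pi * dot (zvec R m) x).

Lemma dotDl d (x y v : 'rV[R]_d) : dot (x + y) v = dot x v + dot y v.
Proof.
by rewrite /dot -big_split; apply: eq_bigr => i _; rewrite mxE mulrDl.
Qed.

Lemma dotDr d (x y v : 'rV[R]_d) : dot v (x + y) = dot v x + dot v y.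
Proof.
by rewrite /dot -big_split; apply: eq_bigr => i _; rewrite mxE mulrDr.
Qed.

Lemma dotZr d c (x v : 'rV[R]_d) : dot v (c *: x) = c * dot v x.
Proof.
by rewrite /dot mulr_sumr; apply: eq_bigr => i _; rewrite mxE mulrCA.
Qed.

Lemma dotNl d (x v : 'rV[R]_d) : dot (- x) v = - dot x v.
Proof.
by rewrite /dot -sumrN; apply: eq_bigr => i _; rewrite mxE mulNr.
Qed.

Lemma dotC d (x v : 'rV[R]_d) : dot x v = dot v x.
Proof. by apply: eq_bigr => i _; rewrite mulrC. Qed.

Lemma zvecD d (m n : 'rV[int]_d) : zvec R (m + n) = zvec R m + zvec R n.
Proof. by apply/rowP => i; rewrite !mxE intrD. Qed.

Lemma zvecN d (m : 'rV[int]_d) : zvec R (- m) = - zvec R m.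
Proof. by apply/rowP => i; rewrite !mxE mulrNz. Qed.

Lemma zvec0 d : zvec R (0 : 'rV[int]_d) = 0.
Proof. by apply/rowP => i; rewrite !mxE. Qed.

Lemma chrD d (m n : 'rV[int]_d) x : chr (m + n) x = chr m x * chr n x.
Proof. by rewrite /chr zvecD dotDl mulrDr cisD. Qed.

Lemma chrN d (m : 'rV[int]_d) x : chr (- m) x = (chr m x)^*.
Proof. by rewrite /chr zvecN dotNl mulrN cisN. Qed.

Lemma chr0 d x : chr (0 : 'rV[int]_d) x = 1.
Proof.
by rewrite /chr zvec0 /dot big1 ?mulr0 ?cis0 // => i _; rewrite mxE mul0r.
Qed.

Lemma chr_addr d (m : 'rV[int]_d) x y : chr m (x + y) = chr m x * chr m y.
Proof. by rewrite /chr dotDr mulrDr cisD. Qed.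

Lemma normc_chr d (m : 'rV[int]_d) x : normc (chr m x) = 1.
Proof. exact: normc_cis. Qed.

Lemma chr_zvec d (m n : 'rV[int]_d) : chr m (zvec R n) = 1.
Proof.
rewrite /chr (_ : dot _ _ = (\sum_i m 0 i * n 0 i)%:~R) ?cis_2pi_int //.
by rewrite rmorph_sum; apply: eq_bigr => i _; rewrite !mxE rmorphM.
Qed.

Definition bucC d (f : 'rV[R]_d -> R[i]) : Prop :=
  buc (fun x => complex.Re (f x)) /\ buc (fun x => complex.Im (f x)).

Lemma bucC_cst d (c : R[i]) : bucC (fun _ : 'rV[R]_d => c).
Proof. by split; exact: buc_cst. Qed.

Lemma bucCD d (f g : 'rV[R]_d -> R[i]) : bucC f -> bucC g ->
  bucC (fun x => f x + g x).
Proof.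
move=> [f1 f2] [g1 g2]; split.
  by under eq_fun do rewrite ReD; exact: bucD.
by under eq_fun do rewrite ImD; exact: bucD.
Qed.

Lemma bucCM d (f g : 'rV[R]_d -> R[i]) : bucC f -> bucC g ->
  bucC (fun x => f x * g x).
Proof.
move=> [f1 f2] [g1 g2]; split.
  under eq_fun do rewrite ReM.
  by apply: bucD; [exact: bucM|apply: bucN; exact: bucM].
by under eq_fun do rewrite ImM; apply: bucD; exact: bucM.
Qed.

Lemma bucC_conj d (f : 'rV[R]_d -> R[i]) : bucC f -> bucC (fun x => (f x)^*).
Proof.
move=> [f1 f2]; split.
  by move: f1; congr buc; apply/funext => x; case: (f x).
by move: (bucN f2); congr buc; apply/funext => x; case: (f x).
Qed.

Lemma bucCN d (f : 'rV[R]_d -> R[i]) : bucC f -> bucC (fun x => - f x).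
Proof.
move=> [/bucN f1 /bucN f2].
by split; [move: f1|move: f2]; congr buc; apply/funext => x; case: (f x).
Qed.

Lemma bucC_sum d (I : Type) (r : seq I) (P : pred I)
    (F : I -> 'rV[R]_d -> R[i]) : (forall i, bucC (F i)) ->
  bucC (fun x => \sum_(i <- r | P i) F i x).
Proof.
move=> bF; split.
  under eq_fun do rewrite Re_sum.
  by apply: buc_sum => i; have [] := bF i.
under eq_fun do rewrite Im_sum.
by apply: buc_sum => i; have [] := bF i.
Qed.

Lemma dotZl d c (x v : 'rV[R]_d) : dot (c *: x) v = c * dot x v.
Proof. by rewrite dotC dotZr dotC. Qed.

Lemma sin_cos_shift (t : R) : sin t = cos (t + - (pi / 2)).
Proof. by rewrite cosB cos_pihalf sin_pihalf mulr0 add0r mulr1. Qed.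

Lemma bucC_chr d (m : 'rV[int]_d) : bucC (chr m).
Proof.
split.
  have := buc_cos ((2 * pi) *: zvec R m) 0; congr buc; apply/funext => x.
  by rewrite addr0 dotZl.
have := buc_cos ((2 * pi) *: zvec R m) (- (pi / 2)); congr buc.
by apply/funext => x; rewrite dotZl -sin_cos_shift.
Qed.

Lemma torus_integralD d (f g : 'rV[R]_d -> R[i]) : bucC f -> bucC g ->
  torus_integral (fun x => f x + g x) = torus_integral f + torus_integral g.
Proof.
move=> [f1 f2] [g1 g2]; rewrite /torus_integral.
under eq_fun do rewrite ReD.
rewrite cube_integralD //; apply: complex_ext => //=.
by under eq_fun do rewrite ImD; rewrite cube_integralD.
Qed.

Lemma torus_integralZ d c (f : 'rV[R]_d -> R[i]) : bucC f ->
  torus_integral (fun x => c * f x) = c * torus_integral f.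
Proof.
move=> [f1 f2]; apply: complex_ext; rewrite ?ReM ?ImM /=.
  under eq_fun do rewrite ReM -mulNr.
  by rewrite cube_integralD ?cube_integralZ ?mulNr //; exact: bucZ.
under eq_fun do rewrite ImM.
by rewrite cube_integralD ?cube_integralZ //; exact: bucZ.
Qed.

Lemma torus_integral_cst d (c : R[i]) :
  torus_integral (fun _ : 'rV[R]_d => c) = c.
Proof.
by rewrite /torus_integral !cube_integral_cst; case: c.
Qed.

Lemma torus_integral_sum d (I : Type) (r : seq I) (P : pred I)
    (F : I -> 'rV[R]_d -> R[i]) : (forall i, bucC (F i)) ->
  torus_integral (fun x => \sum_(i <- r | P i) F i x) =
  \sum_(i <- r | P i) torus_integral (F i).
Proof.
move=> bF; apply: complex_ext => /=.
  rewrite Re_sum; under eq_fun do rewrite Re_sum.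
  by rewrite cube_integral_sum // => i; have [] := bF i.
rewrite Im_sum; under eq_fun do rewrite Im_sum.
by rewrite cube_integral_sum // => i; have [] := bF i.
Qed.

Lemma torus_integral_conj d (f : 'rV[R]_d -> R[i]) : bucC f ->
  torus_integral (fun x => (f x)^*) = (torus_integral f)^*.
Proof.
move=> [f1 f2]; apply: complex_ext => /=.
  by congr cube_integral; apply/funext => x; case: (f x).
rewrite -mulN1r -cube_integralZ //.
by congr cube_integral; apply/funext => x; rewrite mulN1r; case: (f x).
Qed.

Lemma torus_integral_chr d (m : 'rV[int]_d) :
  torus_integral (chr m) = (m == 0)%:R.
Proof.
apply: complex_ext => /=.
  have := cube_integral_cos m (0 : R); rewrite cos0 mulr1.
  under eq_fun do rewrite addr0.
  by move=> ->; case: (m == 0).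
under eq_fun do rewrite sin_cos_shift.
by rewrite cube_integral_cos cosN cos_pihalf mulr0; case: (m == 0).
Qed.

Lemma fourierE d (f : 'rV[R]_d -> R[i]) m :
  fourier f m = torus_integral (fun x => f x * (chr m x)^*).
Proof.
congr torus_integral; apply/funext => x.
by rewrite cisN.
Qed.

Lemma fourier0 d (f : 'rV[R]_d -> R[i]) : fourier f 0 = torus_integral f.
Proof.
rewrite fourierE; congr torus_integral; apply/funext => x.
by rewrite chr0 rmorph1 mulr1.
Qed.

Lemma le_Re_torus_integral d (f g : 'rV[R]_d -> R[i]) : bucC f -> bucC g ->
  (forall x, complex.Re (f x) <= complex.Re (g x)) ->
  complex.Re (torus_integral f) <= complex.Re (torus_integral g).
Proof. by move=> [f1 _] [g1 _] fg; exact: le_cube_integral. Qed.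

(** The mean square of [f - S], with [S] the partial Fourier sum, is nonnegative and equals the mean
    square of [f] minus [Q]. The sup bound [B] stands in for the L2 norm of [f]. *)
Lemma bessel d (T : finType) (mu : T -> 'rV[int]_d) (f : 'rV[R]_d -> R[i])
    (B : R) : injective mu -> bucC f -> (forall x, normc (f x) <= B) ->
  \sum_a normc (fourier f (mu a)) ^+ 2 <= B ^+ 2.
Proof.
move=> mu_inj bf fB; pose c a := fourier f (mu a).
pose S x := \sum_a c a * chr (mu a) x.
have bchr a : bucC (fun x => c a * chr (mu a) x).
  by apply: bucCM; [exact: bucC_cst|exact: bucC_chr].
have bS : bucC S by apply: bucC_sum.
have bSc := bucC_conj bS; have bfc := bucC_conj bf.
pose Q := \sum_a (normc (c a) ^+ 2)%:C.
have fS : torus_integral (fun x => f x * (S x)^*) = Q.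
  transitivity (torus_integral
      (fun x => \sum_a (c a)^* * (f x * (chr (mu a) x)^*))).
    congr torus_integral; apply/funext => x.
    rewrite rmorph_sum mulr_sumr; apply: eq_bigr => a _.
    by rewrite rmorphM mulrCA.
  have bfa a : bucC (fun x => f x * (chr (mu a) x)^*).
    by apply: bucCM => //; apply: bucC_conj; exact: bucC_chr.
  rewrite torus_integral_sum => [|a]; last first.
    by apply: bucCM => //; exact: bucC_cst.
  by apply: eq_bigr => a _; rewrite torus_integralZ // -fourierE mulrC sqr_normcC.
have SS : torus_integral (fun x => S x * (S x)^*) = Q.
  transitivity (torus_integral (fun x => \sum_a \sum_b
      (c a * (c b)^*) * chr (mu a - mu b) x)).
    congr torus_integral; apply/funext => x.
    rewrite rmorph_sum mulr_suml; apply: eq_bigr => a _.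
    rewrite mulr_sumr; apply: eq_bigr => b _.
    by rewrite rmorphM chrD chrN; ring.
  have bab a b : bucC (fun x => (c a * (c b)^*) * chr (mu a - mu b) x).
    by apply: bucCM; [exact: bucC_cst|exact: bucC_chr].
  rewrite torus_integral_sum => [|a]; last exact: bucC_sum.
  apply: eq_bigr => a _; rewrite torus_integral_sum // (bigD1 a) //.
  rewrite torus_integralZ; last exact: bucC_chr.
  rewrite torus_integral_chr subrr eqxx mulr1 -sqr_normcC.
  rewrite big1 => [|b /andP[_ ba]]; first by rewrite [LHS]addr0.
  rewrite torus_integralZ; last exact: bucC_chr.
  rewrite torus_integral_chr subr_eq0 eq_sym (inj_eq mu_inj).
  by rewrite (negPf ba) mulr0.
have Sf : torus_integral (fun x => S x * (f x)^*) = Q.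
  transitivity (torus_integral (fun x => (f x * (S x)^*)^*)).
    congr torus_integral; apply/funext => x.
    by rewrite conjc_mul_conj.
  rewrite torus_integral_conj; last exact: bucCM.
  by rewrite fS rmorph_sum; apply: eq_bigr => a _; exact: conjc_real.
have ff : complex.Re (torus_integral (fun x => f x * (f x)^*)) <= B ^+ 2.
  have := @le_Re_torus_integral d (fun x => f x * (f x)^*) (fun=> (B ^+ 2)%:C).
  rewrite torus_integral_cst; apply; first exact: bucCM.
    exact: bucC_cst.
  move=> x; rewrite -sqr_normcC /= lerXn2r // nnegrE ?normc_ge0 //.
  by apply: le_trans (fB x); exact: normc_ge0.
have : 0 <= complex.Re (torus_integral (fun x => (f x - S x) * (f x - S x)^*)).
  have -> : 0 = complex.Re (torus_integral (fun _ : 'rV[R]_d => 0)).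
    by rewrite torus_integral_cst.
  have bfS : bucC (fun x => f x - S x) by apply: bucCD => //; exact: bucCN.
  apply: le_Re_torus_integral; first exact: bucC_cst.
    by apply: bucCM => //; exact: bucC_conj.
  by move=> x; rewrite -sqr_normcC /= sqr_ge0.
have -> : torus_integral (fun x => (f x - S x) * (f x - S x)^*) =
    torus_integral (fun x => f x * (f x)^*) - Q.
  transitivity (torus_integral (fun x => f x * (f x)^* +
     (S x * (S x)^* + (- f x * (S x)^* + - S x * (f x)^*)))).
    congr torus_integral; apply/funext => x.
    by rewrite rmorphB /=; ring.
  have bSN := bucCN bS; have bfN := bucCN bf.
  rewrite torus_integralD; [|exact: bucCM|]; last first.
    by apply: bucCD; [exact: bucCM|apply: bucCD; exact: bucCM].
  rewrite torus_integralD; [|exact: bucCM|apply: bucCD; exact: bucCM].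
  rewrite torus_integralD; [|exact: bucCM..].
  have neg g h : bucC g -> bucC h ->
      torus_integral (fun x => - g x * h x) =
      - torus_integral (fun x : 'rV[R]_d => g x * h x).
    move=> bg bh; rewrite -mulN1r -torus_integralZ; last exact: bucCM.
    by congr torus_integral; apply/funext => x; rewrite mulN1r mulNr.
  by rewrite !neg // fS Sf SS; ring.
rewrite ReD raddfN /= Re_sum subr_ge0 => /le_trans -> //.
Qed.

End TorusIntegral.

(** * Sums over separated points and geometric progressions; Cauchy-Schwarz *)

Section RealSums.
Variable R : realType.
Set Implicit Arguments.
Unset Strict Implicit.
Unset Printing Implicit Defensive.

Lemma ler_sum_inj (T : finType) (P : pred T) (p : T -> nat) (G : nat -> R) K :
  (forall a, P a -> (p a < K)%N) ->
  (forall a b, P a -> P b -> p a = p b -> a = b) ->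
  (forall n, 0 <= G n) ->
  \sum_(a | P a) G (p a) <= \sum_(n < K) G n.
Proof.
case: K => [|K] pK p_inj G0.
  by rewrite big_ord0 big1 // => a /pK.
pose f a : 'I_K.+1 := inord (p a); pose A := [set a | P a]%SET.
have -> : \sum_(a | P a) G (p a) = \sum_(a in A) G (f a).
  apply: eq_big => [a|a Pa]; first by rewrite inE.
  by rewrite /f inordK // pK.
rewrite -(big_imset (fun j : 'I_K.+1 => G j)) /=; last first.
  move=> a b; rewrite !inE => Pa Pb /(congr1 val) /=.
  by rewrite !inordK ?pK //; exact: p_inj.
rewrite [leRHS](bigID [in (f @: A)%SET]) /= lerDl.
by apply: sumr_ge0.
Qed.

Lemma sum_telescope_le (V g : nat -> R) (c : R) K :
  (forall n, V n <= c * (g n.+1 - g n)) ->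
  \sum_(n < K) V n <= c * (g K - g 0%N).
Proof.
move=> Vg; apply: (@le_trans _ _ (\sum_(n < K) c * (g n.+1 - g n))).
  exact: ler_sum.
rewrite -mulr_sumr -(big_mkord xpredT (fun n => g n.+1 - g n)).
by rewrite telescope_sumr.
Qed.

(* [min(1, 1/x^2) <= 4/(1+x)^2], which telescopes along an arithmetic
   progression. *)
Lemma sum_min1_inv_sqr (q : R) K : 0 < q ->
  \sum_(p < K) Num.min 1 ((q * p.+1%:R) ^- 2) <= 4 / q.
Proof.
move=> q0; pose g (p : nat) := - (1 + q * p%:R)^-1.
have pos (n : nat) : 0 < 1 + q * n%:R by rewrite ltr_pwDl // mulr_ge0 // ltW.
apply: (@le_trans _ _ (4 / q * (g K - g 0%N))).
  apply: (@sum_telescope_le (fun p => Num.min 1 ((q * p.+1%:R) ^- 2)) g) => p.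
  rewrite /=.
  have := pos p; have := pos p.+1; rewrite /g.
  rewrite -[p.+1%:R]natr1; have : 0 <= p%:R :> R by [].
  move: (p%:R) => t t0 h1 h0.
  have -> : 4 / q * (- (1 + q * (t + 1))^-1 - - (1 + q * t)^-1) =
      4 / ((1 + q * (t + 1)) * (1 + q * t)).
    by field; apply/and3P; split; apply/eqP; lra.
  set x := q * (t + 1).
  have x0 : 0 < x by rewrite mulr_gt0 //; lra.
  have xt : q * t <= x by rewrite /x; nra.
  have qt0 : 0 <= q * t by rewrite mulr_ge0 // ltW.
  apply: (@le_trans _ _ (4 / ((1 + x) * (1 + x)))); last first.
    rewrite ler_pM2l // lef_pV2 ?posrE ?mulr_gt0 //; try lra.
    by rewrite ler_pM2l; lra.
  rewrite ge_min ler_pdivlMr ?mulr_gt0 //; try lra.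
  rewrite [_ ^- 2 <= _]ler_pdivlMr ?mulr_gt0 //; try lra.
  have [x1|x1] := leP x 1; apply/orP; [left|right]; first nra.
  by rewrite mulrC ler_pdivrMr ?exprn_gt0 //; nra.
rewrite -[leRHS]mulr1 ler_wpM2l ?divr_ge0 //; first exact: ltW.
rewrite /g mulr0 addr0 invr1 opprK gerDr oppr_le0 invr_ge0.
exact: ltW.
Qed.

(** With y the general term, min(y, 1/y) <= 4y/(1+y)^2, which is dominated by an increment of
    y/(1+y). The total increment is at most 1, whence a bound free of the starting point [x] and the
    length [K]. *)
Lemma sum_min_geometric (x r : R) K : 0 < x -> 1 < r ->
  \sum_(j < K) Num.min (x * r ^+ j) (x * r ^+ j)^-1 <= 4 * r / (r - 1).
Proof.
move=> x0 r1; pose y (j : nat) := x * r ^+ j.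
have y0 j : 0 < y j by rewrite mulr_gt0 // exprn_gt0 //; lra.
pose g j := y j / (1 + y j).
apply: (@le_trans _ _ (4 * r / (r - 1) * (g K - g 0%N))).
  apply: (@sum_telescope_le (fun j => Num.min (y j) (y j)^-1) g) => j.
  rewrite /= /g.
  have -> : y j.+1 = r * y j by rewrite /y exprS; ring.
  have := y0 j; move: (y j) => t t0.
  have rt0 : 0 < r * t by apply: mulr_gt0 => //; lra.
  have -> : 4 * r / (r - 1) * (r * t / (1 + r * t) - t / (1 + t)) =
      4 * r * t / ((1 + r * t) * (1 + t)).
    by field; apply/and3P; split; apply/eqP; lra.
  apply: (@le_trans _ _ (4 * t / ((1 + t) * (1 + t)))); last first.
    rewrite ler_pdivlMr ?mulr_gt0 //; try lra.
    rewrite mulrAC ler_pdivrMr ?mulr_gt0 //; try lra.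
    have : 0 <= (r - 1) * (t * (1 + t)) by rewrite !mulr_ge0 //; lra.
    by move=> h; nra.
  rewrite ge_min ler_pdivlMr ?mulr_gt0 //; try lra.
  rewrite [t^-1 <= _]ler_pdivlMr ?mulr_gt0 //; try lra.
  have [t1|t1] := leP t 1; apply/orP; [left|right]; first nra.
  by rewrite mulrC ler_pdivrMr //; nra.
rewrite -[leRHS]mulr1 ler_wpM2l //.
  by rewrite divr_ge0 ?mulr_ge0 //; lra.
have h j : 0 <= g j <= 1.
  have := y0 j; rewrite /g => yj; rewrite divr_ge0 ?ler_pdivrMr /=; lra.
by have /andP[? _] := h 0%N; have /andP[_ ?] := h K; lra.
Qed.

Lemma ln1D_ge (z : R) : 0 <= z -> z / (1 + z) <= ln (1 + z).
Proof.
move=> z0; have h : 0 < 1 + z by lra.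
have := @le_ln1Dx R (- (z / (1 + z))).
have -> : 1 + - (z / (1 + z)) = (1 + z)^-1 by field; apply/eqP; lra.
rewrite lnV ?posrE // lerN2 => ->; rewrite // ltrN2.
by rewrite ltr_pdivrMr //; lra.
Qed.

(** For large [x] the terms stay at 1 for about log x / log(1/v) indices before decaying.
    Telescoping with -ln(1+y) counts this plateau and sums the tail at once. *)
Lemma sum_min1_geometric (x v : R) K : 0 < x -> 0 < v < 1 ->
  \sum_(j < K) Num.min 1 (x * v ^+ j) <= 4 / (1 - v) * ln (1 + x).
Proof.
move=> x0 /andP[v0 v1]; pose y (j : nat) := x * v ^+ j.
have y0 j : 0 < y j by rewrite mulr_gt0 // exprn_gt0 //; lra.
pose g j := - ln (1 + y j).
apply: (@le_trans _ _ (4 / (1 - v) * (g K - g 0%N))).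
  apply: (@sum_telescope_le (fun j => Num.min 1 (y j)) g) => j.
  rewrite /= /g.
  have -> : y j.+1 = v * y j by rewrite /y exprS; ring.
  have := y0 j; move: (y j) => t t0.
  have vt0 : 0 < v * t by apply: mulr_gt0.
  have -> : - ln (1 + v * t) - - ln (1 + t) = ln ((1 + t) / (1 + v * t)).
    by rewrite ln_div ?posrE; [rewrite opprK addrC|lra|lra].
  pose z := (1 - v) * t / (1 + v * t).
  have z0 : 0 <= z by rewrite /z divr_ge0 ?mulr_ge0 //; lra.
  have -> : (1 + t) / (1 + v * t) = 1 + z by rewrite /z; field; apply/eqP; lra.
  apply: (@le_trans _ _ (4 / (1 - v) * (z / (1 + z)))); last first.
    by rewrite ler_pM2l ?ln1D_ge // divr_gt0 //; lra.
  have -> : 4 / (1 - v) * (z / (1 + z)) = 4 * t / (1 + t).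
    rewrite /z; field; apply/and3P; split; apply/eqP; nra.
  rewrite ge_min !ler_pdivlMr; try lra.
  have [t1|t1] := leP t 1; apply/orP; [right|left]; nra.
rewrite ler_pM2l ?divr_gt0 //; try lra.
rewrite /g opprK /y expr0 mulr1 gerDr oppr_le0 ln_ge0 // lerDl.
by have := y0 K; rewrite /y => /ltW.
Qed.

(** Cut the half-line into cells of length [q]: separation leaves at most one point in each, and the
    sum is compared with an arithmetic progression. The shift by one in [p] accounts for the empty
    cell [0, q). *)
Lemma sum_separated_ge0 (T : finType) (P : pred T) (s : T -> R) (q : R) :
  0 < q -> (forall a, P a -> q <= s a) ->
  (forall a b, P a -> P b -> a != b -> q <= `|s a - s b|) ->
  \sum_(a | P a) Num.min 1 ((s a) ^- 2) <= 4 / q.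
Proof.
move=> q0 sq ssep; pose p a := (Num.truncn (s a / q)).-1.
pose G n := Num.min 1 ((q * n.+1%:R) ^- 2).
have tr a : P a -> (p a).+1%:R <= s a / q < (p a).+2%:R.
  move=> Pa; have s1 : 1 <= s a / q by rewrite ler_pdivlMr // mul1r sq.
  rewrite /p prednK ?truncn_gt0 // truncn_itv //.
  by apply: le_trans s1.
apply: (@le_trans _ _ (\sum_(a | P a) G (p a))).
  apply: ler_sum => a Pa; rewrite /G le_min !ge_min lexx /=.
  apply/orP; right; have /andP[h _] := tr _ Pa.
  rewrite lef_pV2 ?posrE ?exprn_gt0 ?mulr_gt0 //; last first.
    by apply: lt_le_trans (sq _ Pa).
  rewrite ler_pXn2r ?nnegrE ?mulr_ge0 //; try exact: ltW.
    by rewrite mulrC -ler_pdivlMr.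
  by apply: le_trans (sq _ Pa); exact: ltW.
pose K := (\max_(a : T) p a).+1.
apply: le_trans (sum_min1_inv_sqr K q0).
apply: (@ler_sum_inj _ P p G K).
- by move=> a _; rewrite /K ltnS; exact: leq_bigmax.
- move=> a b Pa Pb pab; apply/eqP; apply: contraT => /(ssep _ _ Pa Pb).
  have /andP[ha1 ha2] := tr _ Pa; have /andP[hb1 hb2] := tr _ Pb.
  rewrite leNgt => /negP[]; rewrite -pab in hb1 hb2.
  rewrite -[ltRHS]mul1r -ltr_pdivrMr // -[X in _ / X](gtr0_norm q0) -normf_div.
  rewrite mulrBl ltr_norml.
  move: ha2 hb2; rewrite -[(p a).+2%:R]natr1; lra.
- by move=> n; rewrite le_min ler01 invr_ge0 exprn_ge0 // mulr_ge0 // ltW.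
Qed.

Lemma sum_separated (T : finType) (P : pred T) (s : T -> R) (q : R) :
  0 < q -> (forall a, P a -> q <= `|s a|) ->
  (forall a b, P a -> P b -> a != b -> q <= `|s a - s b|) ->
  \sum_(a | P a) Num.min 1 (`|s a| ^- 2) <= 8 / q.
Proof.
move=> q0 sq ssep; rewrite (bigID (fun a => 0 <= s a)) /=.
have -> : 8 / q = 4 / q + 4 / q by rewrite -mulrDl -natrD.
apply: lerD.
  rewrite (eq_bigr (fun a => Num.min 1 (s a ^- 2))); last first.
    by move=> a /andP[_ /ger0_norm ->].
  apply: sum_separated_ge0 => // [a /andP[/sq h /ger0_norm <-]//|a b].
  by move=> /andP[Pa _] /andP[Pb _]; exact: ssep.
rewrite (eq_bigr (fun a => Num.min 1 ((- s a) ^- 2))); last first.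
  by move=> a /andP[_]; rewrite -ltNge => /ltr0_norm ->.
apply: sum_separated_ge0 => // [a /andP[/sq h]|a b].
  by rewrite -ltNge => /ltr0_norm <-.
by move=> /andP[Pa _] /andP[Pb _] /(ssep _ _ Pa Pb); rewrite -opprD normrN.
Qed.

(** The first bound serves small [q], the second large [q], where every term is in the decaying
    range. The second is the estimate with exponent 2 applied to the points [s a / q], which have
    gap 1 and modulus at least 1. *)
Lemma sum_separated_pow (T : finType) (P : pred T) (s : T -> R) (q : R) k :
  (0 < k)%N -> 0 < q -> (forall a, P a -> q <= `|s a|) ->
  (forall a b, P a -> P b -> a != b -> q <= `|s a - s b|) ->
  \sum_(a | P a) Num.min 1 (`|s a| ^- (2 * k)) <= 8 / q /\
  \sum_(a | P a) Num.min 1 (`|s a| ^- (2 * k)) <= 8 / q ^+ (2 * k).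
Proof.
move=> k0 q0 sq ssep; split.
  apply: le_trans (sum_separated q0 sq ssep); apply: ler_sum => a Pa.
  rewrite le_min !ge_min lexx /=.
  have sa0 : 0 < `|s a| by apply: lt_le_trans (sq _ Pa).
  have [s1|s1] := leP `|s a| 1.
    by rewrite invf_ge1 ?exprn_gt0 // exprn_ile1.
  rewrite orbC lef_pV2 ?posrE ?exprn_gt0 //.
  by rewrite ler_weXn2l ?(ltW s1) // -[leqLHS]muln1 leq_mul2l.
have sq' a : P a -> 1 <= `|s a / q|.
  by move=> Pa; rewrite normf_div (gtr0_norm q0) ler_pdivlMr // mul1r sq.
have ssep' a b : P a -> P b -> a != b -> 1 <= `|s a / q - s b / q|.
  move=> Pa Pb ab; rewrite -mulrBl normf_div (gtr0_norm q0) ler_pdivlMr //.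
  by rewrite mul1r ssep.
have := sum_separated ltr01 sq' ssep'; rewrite divr1 => h8.
rewrite [leRHS]mulrC -ler_pdivrMl ?invr_gt0 ?exprn_gt0 // invrK.
apply: le_trans h8; rewrite mulr_sumr; apply: ler_sum => a Pa.
have h := sq' _ Pa.
have sa0 : 0 < `|s a| by apply: lt_le_trans (sq _ Pa).
have h2 : `|s a / q| ^- 2 <= 1.
  by rewrite invf_le1 ?exprn_gt0 ?exprn_ege1 // (lt_le_trans ltr01).
rewrite [leRHS]min_r //; apply: (@le_trans _ _ (q ^+ (2 * k) * `|s a| ^- (2 * k))).
  by rewrite ler_pM2l ?exprn_gt0 // ge_min lexx orbT.
have -> : q ^+ (2 * k) * `|s a| ^- (2 * k) = `|s a / q| ^- (2 * k).
  by rewrite normf_div (gtr0_norm q0) expr_div_n invf_div.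
rewrite lef_pV2 ?posrE ?exprn_gt0 ?(lt_le_trans ltr01) //.
by rewrite ler_weXn2l // -[leqLHS]muln1 leq_mul2l.
Qed.

(** Normalise both families and use 2xy <= x^2 + y^2. Since [X] or [Z] may be 0, both are first
    enlarged by a small [t]. *)
Lemma cauchy_schwarz (T : finType) (P : pred T) (x y : T -> R) (X Z : R) :
  0 <= X -> 0 <= Z -> \sum_(a | P a) x a ^+ 2 <= X ^+ 2 ->
  \sum_(a | P a) y a ^+ 2 <= Z ^+ 2 -> \sum_(a | P a) x a * y a <= X * Z.
Proof.
move=> X0 Z0 xX yZ; apply/ler_addgt0Pr => e e0.
pose S := X + Z + 1; have S0 : 0 < S by rewrite /S; lra.
(* As t <= 1, this gives (X + t)(Z + t) <= XZ + t S <= XZ + e. *)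
pose t := Num.min 1 (e / S); have t0 : 0 < t.
  by rewrite lt_min ltr01 divr_gt0.
have t1 : t <= 1 by rewrite ge_min lexx.
have tS : t * S <= e by rewrite -ler_pdivlMr // ge_min lexx orbT.
pose X' := X + t; pose Z' := Z + t.
have X'0 : 0 < X' by rewrite /X'; lra.
have Z'0 : 0 < Z' by rewrite /Z'; lra.
apply: (@le_trans _ _ (X' * Z')); last by rewrite /X' /Z' /S in tS *; nra.
have xX' : (X' ^+ 2)^-1 * \sum_(a | P a) x a ^+ 2 <= 1.
  rewrite mulrC ler_pdivrMr ?exprn_gt0 // mul1r; apply: le_trans xX _.
  by rewrite /X'; nra.
have yZ' : (Z' ^+ 2)^-1 * \sum_(a | P a) y a ^+ 2 <= 1.
  rewrite mulrC ler_pdivrMr ?exprn_gt0 // mul1r; apply: le_trans yZ _.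
  by rewrite /Z'; nra.
apply: (@le_trans _ _ (X' * Z' / 2 * ((X' ^+ 2)^-1 * \sum_(a | P a) x a ^+ 2 +
    (Z' ^+ 2)^-1 * \sum_(a | P a) y a ^+ 2))); last first.
  rewrite -[leRHS]mulr1 (_ : X' * Z' * 1 = X' * Z' / 2 * (1 + 1)); last first.
    by field.
  by rewrite ler_pM2l ?divr_gt0 ?mulr_gt0 //; exact: lerD.
rewrite !mulr_sumr -big_split mulr_sumr; apply: ler_sum => a _ /=.
have -> : X' * Z' / 2 * (X' ^- 2 * x a ^+ 2 + Z' ^- 2 * y a ^+ 2) =
   x a * y a + X' * Z' / 2 * (x a / X' - y a / Z') ^+ 2.
  by field; apply/andP; split; apply/eqP; lra.
by rewrite lerDl mulr_ge0 ?sqr_ge0 // divr_ge0 // mulr_ge0 // ltW.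
Qed.

End RealSums.

(** * Summation of the dyadic blocks in the three regimes of [Y] *)

Section DyadicSums.
Variable R : realType.
Set Implicit Arguments.
Unset Strict Implicit.
Unset Printing Implicit Defensive.

Lemma eq_ler (x y : R) : x = y -> x <= y.
Proof. by move=> ->. Qed.

Lemma powR_1 (p : R) : 1 `^ p = 1 :> R.
Proof. by rewrite /powR oner_eq0 ln1 mulr0 expR0. Qed.

Lemma powRX (x p : R) n : 0 <= x -> (x ^+ n) `^ p = (x `^ p) ^+ n.
Proof.
move=> x0; elim: n => [|n IH]; first by rewrite !expr0 powR_1.
by rewrite !exprS powRM ?exprn_ge0 // IH.
Qed.

Lemma powRDp (x p q : R) : 0 < x -> x `^ (p + q) = x `^ p * x `^ q.
Proof. by move=> x0; rewrite powRD //; apply/implyP => _; rewrite gt_eqF. Qed.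

Lemma powR_ge1 (x p : R) : 1 <= x -> 0 <= p -> 1 <= x `^ p.
Proof. by move=> x1 p0; rewrite -(powRr0 x) ler_powR. Qed.

Lemma powR_gt1 (x p : R) : 1 < x -> 0 < p -> 1 < x `^ p.
Proof.
move=> x1 p0; rewrite /powR gt_eqF ?(lt_trans ltr01) //.
by rewrite expR_gt1 mulr_gt0 // ln_gt0.
Qed.

Lemma powR_le1_antimono (x p q : R) : 0 < x <= 1 -> p <= q -> x `^ q <= x `^ p.
Proof.
move=> /andP[x0 x1] pq; rewrite /powR gt_eqF // ler_expR.
by rewrite ler_wnM2r // ln_le0.
Qed.

(** The peak lies where [w * rho ^+ j] passes 1. Once the blocks are normalised to be at most 1
    there, only the rate [eta] matters, so the constant does not see [w], which will carry the
    dependence on [N]. *)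
Lemma dyadic_peak (V : nat -> R) (w rho eta : R) K :
  0 < w -> 1 < rho -> 0 < eta ->
  (forall j, w * rho ^+ j <= 1 -> V j <= (w * rho ^+ j) `^ eta) ->
  (forall j, 1 <= w * rho ^+ j -> V j <= (w * rho ^+ j) `^ (- eta)) ->
  \sum_(j < K) V j <= 4 * rho `^ eta / (rho `^ eta - 1).
Proof.
move=> w0 r1 e0 Vle Vge.
have wr j : 0 < w * rho ^+ j by rewrite mulr_gt0 // exprn_gt0 //; lra.
apply: le_trans (sum_min_geometric K (powR_gt0 eta w0) (powR_gt1 r1 e0)).
apply: ler_sum => j _.
rewrite -powRX -?powRM ?exprn_ge0 //; try lra.
rewrite -powRN le_min; have [h|h] := leP (w * rho ^+ j) 1.
  rewrite Vle //=; apply: le_trans (Vle _ h) _.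
  apply: powR_le1_antimono; [by rewrite wr h|lra].
rewrite Vge ?(ltW h) // andbT; apply: le_trans (Vge _ (ltW h)) _.
by rewrite ler_powR ?(ltW h) //; lra.
Qed.

(** [T j] stands for the sum of the truncated kernel bounds over block [j]. Its three upper bounds
    come from the spacing of the points, first for close points and then for points in the decaying
    range, and from their number. *)
Lemma dyadic_sum (d : nat) (delta sigma C : R) (k : nat) :
  (0 < d)%N -> d%:R / 2 < delta -> d%:R <= sigma -> 0 < C -> (0 < k)%N ->
  2 * delta / sigma <= k%:R ->
  exists2 c : R, 0 < c & forall (N K : nat) (T : nat -> R), (1 <= N)%N ->
    (forall j, T j <= C * ((2 ^+ j) `^ sigma / N%:R)) ->
    (forall j, T j <= C * ((2 ^+ j) `^ sigma / N%:R) ^+ (2 * k)) ->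
    (forall j, T j <= C * (2 ^+ j) ^+ d) ->
    \sum_(j < K) (2 ^+ j) `^ (- (2 * delta)) * T j <=
    c * (N%:R `^ (- (delta / sigma)) * Y d delta sigma N) ^+ 2.
Proof.
move=> d0 hdelta hsigma C0 k0 hk.
have dR : 1 <= d%:R :> R by rewrite ler1n.
have s0 : 0 < sigma by lra.
have two1 : 1 < 2 :> R by lra.
have p2 j : 0 < 2 ^+ j :> R by apply: exprn_gt0.
(* In the last two regimes the square of [Y] has one logarithm more than the sum produces; this
   lower bound absorbs it into a factor 2. *)
have lnN (N : nat) : (1 <= N)%N -> 2^-1 <= ln (1 + N%:R) :> R.
  move=> N1; have N1' : 1 <= N%:R :> R by rewrite ler1n.
  have N0 : 0 <= N%:R :> R by [].
  apply: le_trans (ln1D_ge N0); rewrite ler_pdivlMr; lra.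
rewrite /Y; case: (boolP (delta / sigma < 1 / 2)) => [dslt|].
  have ds : 2 * delta < sigma.
    by move: dslt; rewrite ltr_pdivrMr //; lra.
  (* The growth and decay rates of the blocks, in powers of 2^j, on the two sides of the crossing of
     2^(j sigma) / N with 2^(j d). As a + b = sigma - d, the crossing is at 2^j = N^(1/(a + b)),
     that is at [w * 2 ^+ j] equal to 1. *)
  pose a := sigma - 2 * delta; pose b := 2 * delta - d%:R.
  have a0 : 0 < a by rewrite /a; lra.
  have b0 : 0 < b by rewrite /b; lra.
  pose eta := Num.min a b.
  have e0 : 0 < eta by rewrite lt_min a0 b0.
  have ea : eta <= a by rewrite ge_min lexx.
  have eb : eta <= b by rewrite ge_min lexx orbT.
  pose r : R := 2 `^ eta.
  have r1 : 1 < r by apply: powR_gt1.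
  exists (C * (4 * r / (r - 1))).
    by rewrite mulr_gt0 // divr_gt0 ?mulr_gt0 //; lra.
  move=> N K T N1 TN _ Td.
  have N0 : 0 < N%:R :> R by rewrite ltr0n.
  set Q := (X in _ <= _ * X).
  have QE : Q = N%:R `^ (- (b / (a + b))).
    rewrite /Q -powRDp // -powR_mulrn ?powR_ge0 // -powRrM; congr (_ `^ _).
    by rewrite /a /b; field; apply/andP; split; apply/eqP; lra.
  have Q0 : 0 < Q by rewrite QE powR_gt0.
  have CQ0 : 0 < C * Q by rewrite mulr_gt0.
  pose w : R := N%:R `^ (- (1 / (a + b))).
  have w0 : 0 < w by rewrite powR_gt0.
  have wp (j : nat) e : (w * 2 ^+ j) `^ e = N%:R `^ (- (e / (a + b))) * (2 ^+ j) `^ e.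
    rewrite powRM ?(ltW w0) ?(ltW (p2 j)) // /w -powRrM; congr (_ `^ _ * _).
    by field; apply/eqP; lra.
  pose V j := (2 ^+ j) `^ (- (2 * delta)) * T j / (C * Q).
  have -> : \sum_(j < K) (2 ^+ j) `^ (- (2 * delta)) * T j =
      C * Q * \sum_(j < K) V j.
    rewrite mulr_sumr; apply: eq_bigr => j _; rewrite /V.
    by field; apply/andP; split; apply/eqP; lra.
  rewrite [leRHS]mulrAC ler_pM2l; last by rewrite mulr_gt0.
  apply: (@dyadic_peak V w 2 eta) => // [j h|j h].
    apply: (@le_trans _ _ ((w * 2 ^+ j) `^ a)); last first.
      by apply: powR_le1_antimono => //; rewrite h mulr_gt0.
    rewrite /V ler_pdivrMr // wp QE.
    apply: (@le_trans _ _ ((2 ^+ j) `^ (- (2 * delta)) *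
        (C * ((2 ^+ j) `^ sigma / N%:R)))).
      by rewrite ler_wpM2l ?powR_ge0.
    have -> : N%:R^-1 = N%:R `^ (- (a / (a + b))) * N%:R `^ (- (b / (a + b))) :> R.
      rewrite -powRDp // -powR_inv1 ?(ltW N0) //; congr (_ `^ _).
      by field; apply/eqP; lra.
    have -> : (2 ^+ j) `^ a = (2 ^+ j) `^ (- (2 * delta)) * (2 ^+ j) `^ sigma :> R.
      by rewrite -powRDp //; congr (_ `^ _); rewrite /a; ring.
    by apply: eq_ler; ring.
  apply: (@le_trans _ _ ((w * 2 ^+ j) `^ (- b))); last first.
    by rewrite ler_powR // lerN2.
  rewrite /V ler_pdivrMr // wp QE.
  apply: (@le_trans _ _ ((2 ^+ j) `^ (- (2 * delta)) * (C * (2 ^+ j) ^+ d))).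
    by rewrite ler_wpM2l ?powR_ge0.
  have -> : (2 ^+ j) `^ (- b) = (2 ^+ j) `^ (- (2 * delta)) * (2 ^+ j) ^+ d :> R.
    rewrite -[(2 ^+ j) ^+ d]powR_mulrn ?(ltW (p2 j)) // -powRDp //.
    by congr (_ `^ _); rewrite /b; ring.
  have : N%:R `^ (- (- b / (a + b))) * N%:R `^ (- (b / (a + b))) = 1 :> R.
    rewrite -powRDp // -[RHS](powRr0 N%:R); congr (_ `^ _).
    by field; apply/eqP; lra.
  move: (N%:R `^ _) (N%:R `^ _) => x y xy; apply: eq_ler.
  transitivity (y * x * ((2 ^+ j) `^ (- (2 * delta)) * (2 ^+ j) ^+ d * C)).
    by rewrite xy; ring.
  by ring.
rewrite -leNgt => dsge; case: (boolP (delta / sigma == 1 / 2)) => [/eqP dseq|dsneq].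
  have ds : 2 * delta = sigma.
    by move/(congr1 (fun t => t * sigma)): dseq; rewrite divfK ?gt_eqF //; lra.
  (* For sigma = 2 delta the spacing bound on a block is [C / N] for every [j]; the cardinality
     bound is [C * v ^+ j] and ends this plateau. *)
  pose v : R := 2 `^ (d%:R - sigma).
  have v0 : 0 < v by rewrite powR_gt0.
  have v1 : v < 1.
    rewrite -(invrK v) invf_lt1 ?invr_gt0 // -powRN.
    by apply: powR_gt1; lra.
  exists (C * (4 / (1 - v)) * 2).
    by rewrite !mulr_gt0 // invr_gt0; lra.
  move=> N K T N1 TN _ Td.
  have N0 : 0 < N%:R :> R by rewrite ltr0n.
  have := lnN _ N1; set L := ln _ => L2.
  have -> : (N%:R `^ (- (delta / sigma)) * L) ^+ 2 = N%:R^-1 * L ^+ 2.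
    rewrite exprMn -[(_ `^ _) ^+ 2]powR_mulrn ?powR_ge0 // -powRrM dseq.
    by rewrite (_ : - (1 / 2) * 2 = -1) ?powR_inv1 ?(ltW N0) //; field.
  apply: (@le_trans _ _ (C / N%:R * \sum_(j < K) Num.min 1 (N%:R * v ^+ j))).
    rewrite mulr_sumr; apply: ler_sum => j _.
    rewrite minr_pMr ?divr_ge0 ?(ltW C0) ?(ltW N0) // le_min mulr1.
    have E1 : (2 ^+ j) `^ (- (2 * delta)) * (2 ^+ j) `^ sigma = 1 :> R.
      by rewrite -powRDp // ds addNr powRr0.
    apply/andP; split.
      apply: (@le_trans _ _ ((2 ^+ j) `^ (- (2 * delta)) *
        (C * ((2 ^+ j) `^ sigma / N%:R)))).
        by rewrite ler_wpM2l ?powR_ge0.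
  by rewrite mulrCA [_ * (_ / _)]mulrA E1 mul1r.
    apply: (@le_trans _ _ ((2 ^+ j) `^ (- (2 * delta)) * (C * (2 ^+ j) ^+ d))).
      by rewrite ler_wpM2l ?powR_ge0.
    have -> : v ^+ j = (2 ^+ j) `^ (- (2 * delta)) * (2 ^+ j) ^+ d.
      rewrite -[(2 ^+ j) ^+ d]powR_mulrn ?(ltW (p2 j)) // -powRDp //.
      by rewrite powRX // /v; congr ((_ `^ _) ^+ _); rewrite ds; ring.
    by apply: eq_ler; field; apply/eqP; lra.
  have v01 : 0 < v < 1 by rewrite v0 v1.
  apply: (@le_trans _ _ (C / N%:R * (4 / (1 - v) * L))).
    by rewrite ler_pM2l ?divr_gt0 // sum_min1_geometric.
  have -> : C * (4 / (1 - v)) * 2 * (N%:R^-1 * L ^+ 2) =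
      C / N%:R * (4 / (1 - v) * (2 * L ^+ 2)).
    by field; apply/andP; split; apply/eqP; lra.
  rewrite ler_pM2l ?divr_gt0 // ler_pM2l ?divr_gt0 //; try lra.
  by nra.
have ds : sigma < 2 * delta.
  have : 1 / 2 < delta / sigma by rewrite lt_neqAle eq_sym dsneq.
  by rewrite ltr_pdivlMr //; lra.
pose theta := 2 * delta / sigma; pose eta := theta - 1.
have th1 : 1 < theta by rewrite /theta ltr_pdivlMr //; lra.
have e0 : 0 < eta by rewrite /eta; lra.
pose rho : R := 2 `^ sigma; have rho1 : 1 < rho by apply: powR_gt1.
pose r : R := rho `^ eta; have r1 : 1 < r by apply: powR_gt1.
exists (C * (4 * r / (r - 1)) * 2).
  by rewrite mulr_gt0 // mulr_gt0 // divr_gt0 ?mulr_gt0 //; lra.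
move=> N K T N1 TN Tk _.
have N0 : 0 < N%:R :> R by rewrite ltr0n.
have := lnN _ N1; set L := ln _ => L2.
set Q : R := N%:R `^ (- theta).
have Q0 : 0 < Q by rewrite powR_gt0.
have -> : (N%:R `^ (- (delta / sigma)) * L `^ (1 / 2)) ^+ 2 = Q * L.
  have L0 : 0 < L by lra.
  rewrite exprMn -[(N%:R `^ _) ^+ 2]powR_mulrn ?powR_ge0 //.
  rewrite -[(L `^ _) ^+ 2]powR_mulrn ?powR_ge0 // -!powRrM; congr (_ * _).
    by congr (_ `^ _); rewrite /theta; field; apply/eqP; lra.
  by rewrite (_ : _ * _ = 1) ?powRr1 ?(ltW L0) //; field.
pose u j : R := N%:R^-1 * rho ^+ j.
have u0 j : 0 < u j by rewrite mulr_gt0 ?invr_gt0 // exprn_gt0 //; lra.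
have uE j : (2 ^+ j) `^ sigma / N%:R = u j by rewrite /u powRX // mulrC.
have pE j : (2 ^+ j) `^ (- (2 * delta)) = Q * u j `^ (- theta).
  have -> : 2 ^+ j = (N%:R * u j) `^ sigma^-1 :> R.
    rewrite /u mulrA divff ?mul1r ?gt_eqF // /rho -powRX // -powRrM.
    by rewrite divff ?gt_eqF // powRr1 // ltW.
  rewrite -powRrM powRM ?(ltW N0) ?(ltW (u0 j)) // /Q.
  by congr (_ `^ _ * _ `^ _); rewrite /theta; field; apply/eqP; lra.
pose V j := u j `^ (- theta) * T j / C.
have -> : \sum_(j < K) (2 ^+ j) `^ (- (2 * delta)) * T j =
    C * Q * \sum_(j < K) V j.
  rewrite mulr_sumr; apply: eq_bigr => j _; rewrite /V pE.
  by field; apply/eqP; lra.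
apply: (@le_trans _ _ (C * Q * (4 * r / (r - 1)))); last first.
  have F0 : 0 < 4 * r / (r - 1) by rewrite divr_gt0 ?mulr_gt0 //; lra.
  rewrite (_ : _ * 2 * _ = C * Q * (4 * r / (r - 1)) * (2 * L)); last by ring.
  by rewrite ler_peMr ?(ltW (mulr_gt0 (mulr_gt0 _ _) _)) //; lra.
rewrite ler_pM2l ?mulr_gt0 //.
apply: (@dyadic_peak V N%:R^-1 rho eta) => // [|j h|j h].
- by rewrite invr_gt0.
- rewrite -/(u j) in h *; rewrite /V ler_pdivrMr //.
  apply: (@le_trans _ _ (u j `^ (- theta) * (C * u j ^+ (2 * k)))).
    by rewrite ler_wpM2l ?powR_ge0 // -uE.
  rewrite mulrCA mulrC ler_pM2r //.
  rewrite -powR_mulrn ?(ltW (u0 j)) // -powRDp //.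
  (* The exponents compare because 2k - theta >= theta - 1, a consequence of k >= theta and k >= 1 -
     here only the former is invoked, through [hk]. *)
  apply: powR_le1_antimono; first by rewrite u0 h.
  by rewrite natrM /eta; move: hk; rewrite -/theta; lra.
- rewrite -/(u j) in h *; rewrite /V ler_pdivrMr //.
  apply: (@le_trans _ _ (u j `^ (- theta) * (C * u j))).
    by rewrite ler_wpM2l ?powR_ge0 // -uE.
  rewrite mulrCA mulrC ler_pM2r //.
  rewrite -{2}[u j]powRr1 ?(ltW (u0 j)) // -powRDp //.
  by apply: eq_ler; congr (_ `^ _); rewrite /eta; ring.
Qed.

End DyadicSums.

(** * Iterated differences of smooth functions; a lower bound for |e(r) - 1| *)

Section FiniteDifferences.
Variable R : realType.
Set Implicit Arguments.
Unset Strict Implicit.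
Unset Printing Implicit Defensive.

(** Sign and direction are those for which multiplying [tsum] by e(t) - 1 takes exactly this
    difference of the samples. The codomain is general because the size bounds are proved on real
    and imaginary parts. *)
Definition fdiff (V : zmodType) (h : R) (u : R -> V) : R -> V :=
  fun x => u (x - h) - u x.

Lemma derive1_shift (u : R -> R) (h x : R) : derivable u (x - h) 1 ->
  is_derive x 1 (fun y => u (y - h)) (derive1 u (x - h)).
Proof.
move=> du.
have d1 : is_derive (x - h) 1 u (derive1 u (x - h)).
  by rewrite derive1E; exact: derivableP.
have d2 : is_derive x 1 (fun y : R => y - h) 1 by exact: is_derive_shift.
by have := @is_derive1_comp R u (fun y => y - h) x _ _ d1 d2; rewrite mulr1.
Qed.

Lemma is_derive_fdiff (u : R -> R) (h x : R) : (forall y, derivable u y 1) ->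
  is_derive x 1 (fdiff h u) (fdiff h (derive1 u) x).
Proof.
move=> du; apply: is_deriveB; first exact: derive1_shift.
by rewrite derive1E; exact: derivableP.
Qed.

Lemma derive1n_fdiff (u : R -> R) (h : R) n : smooth u ->
  derive1n n (fdiff h u) = fdiff h (derive1n n u).
Proof.
move=> su; elim: n => [//|n IH]; rewrite !derive1nS IH.
apply/funext => x; rewrite derive1E.
by have [_ ->] := is_derive_fdiff h x (su n).
Qed.

Lemma smooth_fdiff (u : R -> R) (h : R) : smooth u -> smooth (fdiff h u).
Proof.
move=> su n x; rewrite derive1n_fdiff //.
by have [] := is_derive_fdiff h x (su n).
Qed.

Lemma ler_dist_derive (u : R -> R) (B a b : R) : (forall x, derivable u x 1) ->
  (forall x, `|derive1 u x| <= B) -> `|u a - u b| <= B * `|a - b|.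
Proof.
move=> du uB; wlog ab : a b / a < b => [hw|].
  have [|/hw //|->] := ltgtP a b; first exact: hw.
    by rewrite distrC (distrC a); apply.
  by rewrite !subrr normr0 mulr0.
have dc (x : R) : x \in `]a, b[ -> is_derive x 1 u (derive1 u x).
  by move=> _; rewrite derive1E; exact: derivableP.
have [|c _ E] := MVT ab dc.
  by apply: derivable_within_continuous => x _.
by rewrite distrC E normrM (distrC a) ler_wpM2r.
Qed.

(** Differences commute with derivatives, so the innermost difference can be traded, by the mean
    value theorem, for a factor [h] and one derivative. *)
Lemma iter_fdiff_le (u : R -> R) (h B : R) k : smooth u -> 0 <= h ->
  (forall x, `|derive1n k u x| <= B) ->
  forall x, `|iter k (fdiff h) u x| <= h ^+ k * B.
Proof.
move=> su h0; elim: k u B su => [|k IH] u B su uB x.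
  by rewrite expr0 mul1r; exact: uB.
rewrite iterSr exprSr -mulrA; apply: IH => [|y]; first exact: smooth_fdiff.
rewrite derive1n_fdiff // /fdiff.
apply: le_trans (ler_dist_derive (B := B) _ _ (su k) _) _.
  by move=> z; rewrite -derive1nS.
by rewrite addrAC subrr add0r normrN ger0_norm // mulrC.
Qed.

Lemma derive1n_vanish (u : R -> R) (A : R) k :
  (forall x, A < `|x| -> u x = 0) -> forall x, A < `|x| -> derive1n k u x = 0.
Proof.
move=> u0; elim: k => [//|k IH] x xA; rewrite derive1nS derive1E.
rewrite (@near_eq_derive _ _ _ _ (cst 0)) ?derive_cst //.
have : \forall y \near x, A < `|y|.
  apply/nbhs_ballP; exists (`|x| - A); first by rewrite /= subr_gt0.
  move=> y; rewrite /ball /= => xy; have := ler_normD (x - y) y.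
  by rewrite subrK; lra.
by apply: filterS => y /IH.
Qed.

Lemma derive1n_bounded (u : R -> R) (A : R) k : smooth u -> 0 < A ->
  (forall x, A < `|x| -> u x = 0) ->
  exists2 B, 0 <= B & forall x, `|derive1n k u x| <= B.
Proof.
move=> su A0 u0; have nA : - A <= A by lra.
have cu : {within `[- A, A], continuous (derive1n k u)}.
  by apply: derivable_within_continuous => x _; exact: su.
have [a _ ua] := EVT_max nA cu; have [b _ ub] := EVT_min nA cu.
exists (`|derive1n k u a| + `|derive1n k u b|); first exact: addr_ge0.
move=> x; have [xA|xA] := leP `|x| A; last first.
  by rewrite (derive1n_vanish _ u0) // normr0 addr_ge0.
have xI : x \in `[- A, A] by rewrite in_itv /= -ler_norml.
rewrite ler_norml; apply/andP; split.
  apply: le_trans (ub _ xI); rewrite lerNl.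
  by apply: le_trans (ler_norm _) _; rewrite normrN lerDr.
by apply: le_trans (ua _ xI) _; apply: le_trans (ler_norm _) _; rewrite lerDl.
Qed.

Lemma iter_fdiff_vanish (V : zmodType) (u : R -> V) (h A : R) k : 0 <= h ->
  (forall x, A < `|x| -> u x = 0) ->
  forall x, A + k%:R * h < `|x| -> iter k (fdiff h) u x = 0.
Proof.
move=> h0 u0; elim: k => [|k IH] x; first by rewrite mul0r addr0; exact: u0.
rewrite -natr1 mulrDl mul1r addrA => xA; rewrite /= /fdiff !IH ?subrr //.
  by apply: le_lt_trans xA; rewrite lerDl.
rewrite -(ltrD2r h); apply: lt_le_trans xA _.
rewrite -[in leRHS](ger0_norm h0) -{1}(subrK h x); apply: le_trans (ler_normD _ _) _.
by rewrite (ger0_norm h0).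
Qed.

Lemma iter_fdiff_Re (u : R -> R[i]) (h : R) k x :
  complex.Re (iter k (fdiff h) u x) = iter k (fdiff h) (fun y => complex.Re (u y)) x.
Proof.
by elim: k x => [//|k IH] x; rewrite /= /fdiff -!IH; case: (iter _ _ _ _);
  case: (iter _ _ _ _).
Qed.

Lemma iter_fdiff_Im (u : R -> R[i]) (h : R) k x :
  complex.Im (iter k (fdiff h) u x) = iter k (fdiff h) (fun y => complex.Im (u y)) x.
Proof.
by elim: k x => [//|k IH] x; rewrite /= /fdiff -!IH; case: (iter _ _ _ _);
  case: (iter _ _ _ _).
Qed.

Lemma iter_fdiffC_bound (u : R -> R[i]) (A : R) k : smoothC u -> 0 < A ->
  (forall x, A < `|x| -> u x = 0) ->
  exists2 B, 0 < B & forall h x, 0 <= h ->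
    normc (iter k (fdiff h) u x) <= h ^+ k * B.
Proof.
move=> [su1 su2] A0 u0.
have [|B1 B10 uB1] := derive1n_bounded k su1 A0; first by move=> x /u0 ->.
have [|B2 B20 uB2] := derive1n_bounded k su2 A0; first by move=> x /u0 ->.
exists (B1 + B2 + 1); first lra.
move=> h x h0; apply: le_trans (normc_le_ReIm _) _.
rewrite iter_fdiff_Re iter_fdiff_Im.
apply: (@le_trans _ _ (h ^+ k * B1 + h ^+ k * B2)).
  by apply: lerD; exact: iter_fdiff_le.
by rewrite -mulrDr ler_wpM2l ?exprn_ge0 // lerDl.
Qed.

Lemma normc_cis_sub1 (r : R) : normc (cis (2 * pi * r) - 1) = 2 * `|sin (pi * r)|.
Proof.
apply: (@pexpIrn _ 2) => //; rewrite ?nnegrE ?normc_ge0 ?mulr_ge0 //.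
rewrite sqr_normcE exprMn real_normK ?num_real // sin2cos2.
have -> : cis (2 * pi * r) = cis (pi * r) * cis (pi * r).
  by rewrite -cisD; congr cis; ring.
rewrite /= !expr2; have := cos2Dsin2 (pi * r); rewrite !expr2.
move: (cos _) (sin _) => c s cs.
have -> : (c * c - s * s - 1) = - 2 * (1 - c * c) by lra.
have -> : (c * s + s * c - 0) * (c * s + s * c - 0) = 4 * (c * c) * (s * s).
  by ring.
have -> : s * s = 1 - c * c by lra.
ring.
Qed.

(** Halve the angle: for r >= 0 and x = pi r / 2 <= pi / 4, sin(2x) = 2 sin x cos x and sin x = x
    cos y with y between 0 and x. Both cosines are at least cos(pi / 4), so their product is at
    least 1/2, and pi >= 2 concludes. *)
Lemma normc_cis_sub1_ge (r : R) : `|r| <= 2^-1 ->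
  2 * `|r| <= normc (cis (2 * pi * r) - 1).
Proof.
rewrite normc_cis_sub1 => r2; rewrite ler_pM2l //.
have -> : `|sin (pi * r)| = `|sin (pi * `|r|)|.
  by case: (ger0P r) => // _; rewrite mulrN sinN normrN.
move: r2 (normr_ge0 r); move: `|r| => {}r r2 r0.
have pi0 := pi_gt0 R; have pi2 := pi_ge2 R.
apply: le_trans (ler_norm _).
have [->|rn0] := eqVneq r 0; first by rewrite mulr0 sin0.
have rp : 0 < r by rewrite lt_neqAle eq_sym rn0.
pose x := pi * r / 2; have x0 : 0 < x by rewrite divr_gt0 // mulr_gt0.
pose c : R := cos (pi / 4).
have c2 : c ^+ 2 = 2^-1.
  have := cos_pihalf R.
  have -> : pi / 2 = (pi / 4) *+ 2 :> R by rewrite -mulr_natr; field.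
  by rewrite cos_mulr2n -/c -mulr_natr; lra.
have c0 : 0 < c by apply: cos_gt0_pihalf; apply/andP; split; lra.
have xle : x <= pi / 4.
  have : pi * r <= pi * 2^-1 by rewrite ler_pM2l.
  by rewrite /x; lra.
have cosx y : 0 <= y -> y <= x -> c <= cos y.
  move=> y0 yx; rewrite leNgt ltr_cos ?in_itv /= -?leNgt; first lra.
    by apply/andP; split; lra.
  by apply/andP; split; lra.
have dsin (y : R) : y \in `]0, x[ -> is_derive y 1 (@sin R) (cos y).
  by move=> _; exact: is_derive_sin.
have [|y] := MVT x0 dsin.
  by apply: continuous_subspaceT => y; exact: continuous_sin.
rewrite in_itv /= sin0 !subr0 => /andP[y0 yx] E.
have -> : pi * r = x *+ 2 by rewrite -mulr_natr /x; field.
rewrite sin_mulr2n E.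
have h1 := cosx _ (ltW y0) (ltW yx); have h2 := cosx _ (ltW x0) (lexx x).
have h3 : c * c <= cos y * cos x.
  by apply: ler_pM => //; exact: ltW.
rewrite -expr2 c2 in h3.
have -> : cos x * (cos y * x) *+ 2 = x *+ 2 * (cos y * cos x).
  by rewrite !mulr2n; ring.
have xr : 2 * r <= x *+ 2.
  by rewrite (_ : x *+ 2 = pi * r) ?ler_pM2r // mulr2n /x; field.
have : x *+ 2 * 2^-1 <= x *+ 2 * (cos y * cos x) by rewrite ler_pM2l //; lra.
by lra.
Qed.

End FiniteDifferences.

(** * Sampled exponential sums and their decay by summation by parts *)

Section TrigonometricSums.
Variable R : realType.
Set Implicit Arguments.
Unset Strict Implicit.
Unset Printing Implicit Defensive.

Definition cidx (K i : nat) : int := i%:Z - K%:Z.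

Lemma cidxR (K i : nat) : (cidx K i)%:~R = i%:R - K%:R :> R.
Proof. by rewrite /cidx rmorphB. Qed.

Lemma fsum_int (V : zmodType) (F : int -> V) (K : nat) :
  (forall n, (K < `|n|)%N -> F n = 0) ->
  \sum_(n \in [set: int]) F n = \sum_(i < (2 * K).+1) F (cidx K i).
Proof.
move=> F0; pose s := [seq cidx K i | i <- iota 0 (2 * K).+1].
have us : uniq s.
  rewrite map_inj_uniq ?iota_uniq // => i j; rewrite /cidx => /addIr.
  by case.
rewrite -(@fsbig_widen _ _ _ _ [set` s] setT) //; last first.
  move=> n /= [_ ns]; apply: F0; rewrite ltnNge; apply/negP => nK; apply: ns.
  apply/mapP; exists (absz (n + K%:Z)%R); first by rewrite mem_iota; lia.
  by rewrite /cidx; lia.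
rewrite -fsbig_seq // big_map -[iota _ _]/(index_iota 0 (2 * K).+1).
by rewrite big_mkord.
Qed.

Definition tsum (G : R -> R[i]) (N K : nat) (t : R) : R[i] :=
  \sum_(i < (2 * K).+1)
    G (N%:R^-1 * (i%:R - K%:R)) * cis (2 * pi * (i%:R - K%:R) * t).

(** Abel summation without boundary terms: as [K] exceeds [A * N], the first shifted sample [b 0]
    and the last sample [a (2 * K)] both vanish. *)
Lemma tsum_fdiff (G : R -> R[i]) (N K : nat) (t A : R) : (0 < N)%N ->
  (forall x, A < `|x| -> G x = 0) -> A * N%:R < K%:R ->
  (cis (2 * pi * t) - 1) * tsum G N K t = tsum (fdiff N%:R^-1 G) N K t.
Proof.
move=> N0 G0 KA; have NR : 0 < N%:R :> R by rewrite ltr0n.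
pose a (i : nat) := G (N%:R^-1 * (i%:R - K%:R)).
pose b (i : nat) := G (N%:R^-1 * (i%:R - K%:R) - N%:R^-1).
pose e (i : nat) : R[i] := cis (2 * pi * (i%:R - K%:R) * t).
have ba i : b i.+1 = a i.
  rewrite /a /b; congr G; rewrite -[i.+1%:R]natr1; field.
  by apply/eqP; lra.
have ee i : cis (2 * pi * t) * e i = e i.+1.
  by rewrite /e -cisD; congr cis; rewrite -[i.+1%:R]natr1; ring.
have van x : K%:R <= `|x| -> G (N%:R^-1 * x) = 0.
  move=> Kx; apply: G0; rewrite normrM ger0_norm ?invr_ge0 //.
  by rewrite mulrC ltr_pdivlMr //; lra.
have b0 : b 0%N = 0.
  rewrite /b (_ : _ - _ = N%:R^-1 * (- (K%:R + 1))); last by ring.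
  by apply: van; rewrite normrN ger0_norm ?lerDl // addr_ge0.
have aK : a (2 * K)%N = 0.
  rewrite /a; apply: van.
  by rewrite mul2n -addnn natrD addrK normr_nat.
have -> : tsum (fdiff N%:R^-1 G) N K t =
    \sum_(i < (2 * K).+1) b i * e i - \sum_(i < (2 * K).+1) a i * e i.
  by rewrite -sumrB; apply: eq_bigr => i _; rewrite -mulrBl.
rewrite mulrBl mul1r; congr (_ - _).
rewrite big_ord_recl b0 mul0r add0r /tsum mulr_sumr big_ord_recr /=.
rewrite -/(a (2 * K)%N) aK mul0r mulr0 addr0; apply: eq_bigr => i _.
by rewrite /bump leq0n add1n ba -ee -/(a i) -/(e i); ring.
Qed.

(** Each difference widens the support by 1/N. Bounding this by 1 lets a window proportional to [N]
    hold all [k] differences. *)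
Lemma tsum_iter_fdiff (G : R -> R[i]) (N K k : nat) (t A : R) : (0 < N)%N ->
  (forall x, A < `|x| -> G x = 0) -> (A + k%:R) * N%:R < K%:R ->
  (cis (2 * pi * t) - 1) ^+ k * tsum G N K t =
  tsum (iter k (fdiff N%:R^-1) G) N K t.
Proof.
move=> N0 G0; have NR : 0 < N%:R :> R by rewrite ltr0n.
have Ni : N%:R^-1 <= 1 :> R by rewrite invf_le1 // ler1n.
elim: k => [|k IH] KA; first by rewrite expr0 mul1r.
have kA : (A + k%:R) * N%:R < K%:R.
  apply: le_lt_trans KA; rewrite -[k.+1%:R]natr1.
  by rewrite ler_pM2r // addrA lerDl.
rewrite exprS -mulrA IH // (@tsum_fdiff _ _ _ _ (A + k%:R)) // => x xA.
apply: (iter_fdiff_vanish _ G0); first by rewrite invr_ge0.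
by apply: le_lt_trans xA; rewrite lerD2l ler_piMr.
Qed.

Lemma normc_tsum_le (G : R -> R[i]) (N K : nat) (t B : R) :
  (forall x, normc (G x) <= B) -> normc (tsum G N K t) <= (2 * K).+1%:R * B.
Proof.
move=> GB; apply: le_trans (ler_normc_sum _ _ _) _.
apply: (@le_trans _ _ (\sum_(i < (2 * K).+1) B)).
  by apply: ler_sum => i _; rewrite Normc.normcM normc_cis mulr1.
by rewrite sumr_const card_ord mulr_natl.
Qed.

(* Each difference quotient of the samples gains a factor [1/N], which beats
   the [N] terms of the sum: this is the decay of the Fourier transform of
   [G] without Poisson summation. *)
Lemma tsum_decay (G : R -> R[i]) (A k : nat) : smoothC G ->
  (forall x, A%:R < `|x| -> G x = 0) ->
  exists2 C : R, 0 < C & forall (N : nat) (n : int) (r : R), (0 < N)%N ->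
    `|r| <= 2^-1 ->
    let S := normc (tsum G N ((A + k).+1 * N) (r + n%:~R)) in
    S <= C * N%:R /\ S * (N%:R * `|r|) ^+ k <= C * N%:R.
Proof.
(* The radius is raised by one to be positive, since [A] may be 0. *)
move=> sG G0; have G0' x : A.+1%:R < `|x| -> G x = 0.
  by move=> h; apply: G0; apply: le_lt_trans h; rewrite ler_nat.
have A0 : 0 < A.+1%:R :> R by rewrite ltr0n.
have [B0 B00 GB0] := iter_fdiffC_bound 0 sG A0 G0'.
have [B B_0 GB] := iter_fdiffC_bound k sG A0 G0'.
pose M := (2 * (A + k).+1).+1; pose C : R := M%:R * (B0 + B).
exists C; first by rewrite mulr_gt0 ?ltr0n //; lra.
move=> N n r N0 r2; set K := ((A + k).+1 * N)%N; set t := r + _.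
have NR : 0 < N%:R :> R by rewrite ltr0n.
have Ni : 0 <= N%:R^-1 :> R by rewrite invr_ge0.
have KM : (2 * K).+1%:R <= M%:R * N%:R :> R.
  by rewrite -natrM ler_nat /K /M; lia.
have M0 : 0 < M%:R :> R by rewrite ltr0n.
move=> S; split.
  apply: (@le_trans _ _ ((2 * K).+1%:R * B0)).
    by apply: normc_tsum_le => x; have := GB0 0 x (lexx 0); rewrite expr0 mul1r.
  apply: (@le_trans _ _ (M%:R * N%:R * B0)); first by rewrite ler_pM2r.
  rewrite (_ : C * _ = M%:R * N%:R * (B0 + B)); last by rewrite /C; ring.
  by rewrite ler_pM2l ?mulr_gt0 //; lra.
have E : cis (2 * pi * t) = cis (2 * pi * r).
  by rewrite /t mulrDr cisD cis_2pi_int mulr1.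
have h1 : normc (cis (2 * pi * t) - 1) ^+ k * S <=
    (2 * K).+1%:R * (N%:R^-1 ^+ k * B).
  rewrite -normc_expr -Normc.normcM (@tsum_iter_fdiff _ _ _ _ _ A%:R) //.
    by apply: normc_tsum_le => x; exact: GB.
  by rewrite -natrD -natrM ltr_nat /K ltn_pmul2r.
have S0 : 0 <= S by exact: normc_ge0.
have h2 : `|r| ^+ k <= normc (cis (2 * pi * t) - 1) ^+ k.
  rewrite lerXn2r ?nnegrE ?normc_ge0 // E.
  by apply: le_trans (normc_cis_sub1_ge r2); rewrite ler_peMl //; lra.
have Nk : 0 < N%:R ^+ k :> R by apply: exprn_gt0.
rewrite exprMn (_ : S * _ = `|r| ^+ k * S * N%:R ^+ k); last by ring.
rewrite -ler_pdivlMr //.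
apply: le_trans (ler_wpM2r S0 h2) _; apply: le_trans h1 _.
apply: (@le_trans _ _ (M%:R * N%:R * (N%:R^-1 ^+ k * B))).
  by rewrite ler_wpM2r // mulr_ge0 ?exprn_ge0 // ltW.
rewrite /C exprVn; have : 0 < (N%:R ^+ k)^-1 :> R by rewrite invr_gt0.
move: (_^-1) => y y0.
rewrite (_ : _ * (y * B) = M%:R * N%:R * y * B); last by ring.
rewrite (_ : M%:R * (B0 + B) * _ * _ = M%:R * N%:R * y * (B0 + B)); last by ring.
by rewrite ler_pM2l ?mulr_gt0 //; lra.
Qed.

Lemma compact_support_bound (Psi : R -> R[i]) : compactly_supported Psi ->
  exists A : nat, forall x, A%:R < `|x| -> Psi x = 0.
Proof.
move=> /compact_bounded[M [_ HM]].
exists (Num.truncn `|M + 1|).+1 => x xA; apply/eqP; apply: contraT => Px.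
have /(_ x) := HM (M + 1) (ltr_pwDr ltr01 (lexx M)).
move=> /(_ (@subset_closure R [set t | Psi t != 0] x Px)) /= h.
have := truncn_itv (normr_ge0 (M + 1)) => /andP[_].
by have := ler_norm (M + 1); lra.
Qed.

End TrigonometricSums.

(** * Uniform approximation of periodic functions by Fejer means *)

Section Fejer.
Variable R : realType.
Set Implicit Arguments.
Unset Strict Implicit.
Unset Printing Implicit Defensive.

Lemma nearest_int (t : R) : exists2 n : int, `|t - n%:~R| <= 2^-1 &
  dist_int t <= `|t - n%:~R|.
Proof.
exists (Num.floor (t + 2^-1)).
  have /andP[h1 h2] := floor_itv (t + 2^-1).
  rewrite intrD in h2; rewrite ler_norml; apply/andP; split; lra.
apply: ge_inf; last by exists (Num.floor (t + 2^-1)).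
by exists 0 => _ [n _ <-].
Qed.

Lemma dist_int_le (t : R) (n : int) : dist_int t <= `|t - n%:~R|.
Proof.
by apply: ge_inf; [exists 0 => _ [k _ <-]|exists n].
Qed.

Lemma cis_sub_int (t : R) (n : int) :
  cis (2 * pi * (t - n%:~R)) = cis (2 * pi * t).
Proof.
by rewrite mulrBr cisD cisN cis_2pi_int conjc1 mulr1.
Qed.

Lemma sub1_Re_cis (t : R) :
  1 - complex.Re (cis t) = normc (cis t - 1) ^+ 2 / 2.
Proof.
rewrite sqr_normcE /=; have := cos2Dsin2 t.
by rewrite !expr2; move: (cos t) (sin t) => c s h; lra.
Qed.

Lemma sub1_Re_cis_ge0 (t : R) : 0 <= 1 - complex.Re (cis t).
Proof. by rewrite sub1_Re_cis divr_ge0 ?sqr_ge0. Qed.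

Lemma sub1_Re_cis_ge (t : R) (n : int) : `|t - n%:~R| <= 2^-1 ->
  2 * `|t - n%:~R| ^+ 2 <= 1 - complex.Re (cis (2 * pi * t)).
Proof.
move=> /normc_cis_sub1_ge; rewrite cis_sub_int sub1_Re_cis => h.
rewrite ler_pdivlMr // (_ : _ * 2 = (2 * `|t - n%:~R|) ^+ 2); last by ring.
by rewrite lerXn2r ?nnegrE ?mulr_ge0 ?normc_ge0.
Qed.

Definition periodic1 d (u : 'rV[R]_d -> R) :=
  forall (x : 'rV[R]_d) (m : 'rV[int]_d), u (x + zvec R m) = u x.

(** Integer translations bring [x] into the unit cube, whose compactness gives both the bound and a
    uniform modulus. *)
Lemma periodic_buc d (u : 'rV[R]_d -> R) :
  continuous u -> periodic1 u -> buc u.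
Proof.
move=> cu pu; pose Q := [set x : 'rV[R]_d | forall i, `[0, 1]%classic (x ord0 i)].
have cQ : compact Q.
  apply: (@rV_compact R d (fun=> `[0, 1]%classic)) => i.
  exact: segment_compact.
have shift (x : 'rV[R]_d) : Q (x + zvec R (- \row_i Num.floor (x 0 i))).
  move=> i; rewrite !mxE /= in_itv /=; have /andP[h1 h2] := floor_itv (x 0 i).
  by rewrite intrD in h2; rewrite rmorphN /=; apply/andP; split; lra.
split.
  have Q0 : Q !=set0 by exists 0 => i; rewrite mxE /= in_itv /= lexx ler01.
  have cn : {within Q, continuous (fun x => `|u x|)}.
    apply: continuous_subspaceT => x.
    by apply: continuous_comp; [exact: cu|exact: norm_continuous].
  have [c _ uc] := EVT_max_rV Q0 cQ cn.
  exists `|u c| => x; rewrite -(pu x (- \row_i Num.floor (x 0 i))).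
  by apply: uc; rewrite inE.
move=> e e0.
(* Only [x] is confined to the cube; [y] may leave it, so points near the boundary need no separate
   treatment. *)
pose P (h : R) (x : 'rV[R]_d) :=
  forall y : 'rV[R]_d, (forall i, `|x 0 i - y 0 i| <= h) -> `|u x - u y| <= e.
have /compact_near_coveringP/(_ R (0^'+) P) := cQ.
have step : forall x : 'rV[R]_d, Q x -> \forall x' \near x & h \near 0^'+, P h x'.
  move=> x _; have e2 : 0 < e / 2 by lra.
  have /cvgrPdist_le/(_ _ e2)/nbhs_ballP[r /= r0 Hr] := cu x.
  have r2 : 0 < r / 2 by lra.
  exists (ball x (r / 2), [set h | h < r / 2]).
    split=> /=; first exact: nbhsx_ballx.
    exact: nbhs_right_lt.
  move=> [x' h] /= [xx' hr] y xy.
  have bx' : ball x r x' by apply: le_ball xx'; lra.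
  have by_ : ball x r y.
    split=> // i j; case: xx' => _ /(_ i j); rewrite /ball /= => xx'j.
    have := xy j; rewrite (ord1 i) in xx'j *.
    rewrite (_ : x 0 j - y 0 j = (x 0 j - x' 0 j) + (x' 0 j - y 0 j)); last by ring.
    move=> h2; apply: le_lt_trans (ler_normD _ _) _; lra.
  have h1 := Hr _ bx'; have h2 := Hr _ by_.
  rewrite (_ : u x' - u y = (u x' - u x) + (u x - u y)); last by ring.
  apply: le_trans (ler_normD _ _) _; rewrite distrC; lra.
move=> /(_ _ step) near_h.
have [h [h0 Ph]] : exists h, 0 < h /\ Q `<=` P h.
  have [h [h0 hQ]] := @filter_ex R 0^'+ _ _ (filterI (nbhs_right_gt 0) near_h).
  by exists h.
exists h => // x y xy.
pose m : 'rV[int]_d := - \row_i Num.floor (x 0 i).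
rewrite -(pu x m) -(pu y m); apply: Ph; first exact: shift.
by move=> i; rewrite !mxE opprD addrACA subrr addr0.
Qed.

Lemma sobolev_bucC d delta (f : 'rV[R]_d -> R[i]) : sobolev delta f -> bucC f.
Proof.
move=> [[cr ci] pf _]; split; apply: periodic_buc => // x m; by rewrite pf.
Qed.

(* Korovkin's trick: integrated against the Fejer kernel, the right-hand side is
   an explicit finite sum, so no concentration estimate for the kernel is
   needed. *)
Lemma periodic_modulus d (u : 'rV[R]_d -> R) e : buc u -> periodic1 u -> 0 < e ->
  exists2 C : R, 0 <= C & forall x y, `|u x - u y| <=
    e + C * \sum_i (1 - complex.Re (cis (2 * pi * (x 0 i - y 0 i)))).
Proof.
move=> [[B uB] uu] pu e0; have [h h0 uh] := uu _ e0.
have B0 : 0 <= B by apply: le_trans (uB 0).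
(* If all coordinates of [x - y] are within [h] of integers, [e] alone suffices. Otherwise one term
   of the sum is at least 2 h^2, and this constant turns it into 2 [B], the trivial bound. *)
exists (B / h ^+ 2); first by rewrite divr_ge0 ?sqr_ge0.
move=> x y; pose s i := 1 - complex.Re (cis (2 * pi * (x 0 i - y 0 i))).
have s0 i : 0 <= s i by exact: sub1_Re_cis_ge0.
have S0 : 0 <= \sum_i s i by exact: sumr_ge0.
have [n nP] : exists n : 'I_d -> int, forall i,
    `|x 0 i - y 0 i - (n i)%:~R| <= 2^-1.
  suff /choice[n ?] : forall i, exists n : int,
      `|x 0 i - y 0 i - n%:~R| <= 2^-1 by exists n.
  by move=> i; have [n ? _] := nearest_int (x 0 i - y 0 i); exists n.
have [allh|] := pselect (forall i, `|x 0 i - y 0 i - (n i)%:~R| <= h).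
  rewrite -(pu y (\row_i n i)); apply: le_trans (uh _ _ _) _.
    move=> i; rewrite !mxE opprD addrA; exact: allh.
  by rewrite lerDl mulr_ge0 // divr_ge0 ?sqr_ge0.
move=> /existsNP[i /negP]; rewrite -ltNge => hi.
have := sub1_Re_cis_ge (nP i); rewrite -/(s i) => si.
have h2 : 2 * h ^+ 2 <= \sum_j s j.
  rewrite (bigD1 i) //=; apply: le_trans (_ : s i <= _); last first.
    by rewrite lerDl sumr_ge0.
  apply: le_trans si; rewrite ler_pM2l // lerXn2r ?nnegrE ?(ltW h0) //.
  exact: ltW.
apply: (@le_trans _ _ (B + B)).
  by apply: le_trans (ler_normB _ _) _; exact: lerD.
apply: (@le_trans _ _ (B / h ^+ 2 * (2 * h ^+ 2))).
  apply: eq_ler; field; apply/eqP; lra.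
apply: (@le_trans _ _ (B / h ^+ 2 * \sum_j s j)).
  by rewrite ler_wpM2l // divr_ge0 ?sqr_ge0.
by rewrite lerDr ltW.
Qed.

(** * The Fejer kernel of a frequency box *)

Section Kernel.
Variables (d M : nat).
Hypothesis M0 : (0 < M)%N.

Local Notation I := {ffun 'I_d -> 'I_M}.

Definition freq (a : I) : 'rV[int]_d := \row_i (a i : nat)%:Z.

Lemma freq_inj : injective freq.
Proof.
move=> a b /rowP ab; apply/ffunP => i; apply: val_inj.
by have := ab i; rewrite !mxE => -[].
Qed.

Definition dkernel (t : 'rV[R]_d) : R[i] := \sum_(a : I) chr (freq a) t.

(** The tensor product Fejer kernel. As a square over the one-sided box [0, M)^d it is visibly
    nonnegative, and its Fourier coefficients come from counting pairs of frequencies. *)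
Definition fkernel (t : 'rV[R]_d) : R := normc (dkernel t) ^+ 2 / (M ^ d)%:R.

Lemma Md_gt0 : 0 < (M ^ d)%:R :> R.
Proof. by rewrite ltr0n expn_gt0 M0. Qed.

Lemma card_freq : #|{: I}| = (M ^ d)%N.
Proof. by rewrite card_ffun !card_ord. Qed.

Lemma fkernelE t : (fkernel t)%:C =
  ((M ^ d)%:R^-1)%:C * \sum_(a : I) \sum_(b : I) chr (freq a - freq b) t.
Proof.
rewrite /fkernel mulrC rmorphM; congr (_ * _); rewrite [LHS]sqr_normcC.
rewrite /dkernel rmorph_sum mulr_suml; apply: eq_bigr => a _.
by rewrite mulr_sumr; apply: eq_bigr => b _; rewrite chrD chrN.
Qed.

Lemma bucC_chr_sub (m : 'rV[int]_d) (x : 'rV[R]_d) : bucC (fun y => chr m (x - y)).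
Proof.
have -> : (fun y => chr m (x - y)) = (fun y => chr m x * (chr m y)^*).
  apply/funext => y; rewrite chr_addr /chr; congr (_ * _).
  by rewrite dotC dotNl dotC mulrN cisN.
by apply: bucCM; [exact: bucC_cst|apply: bucC_conj; exact: bucC_chr].
Qed.

Lemma chr_subE (m : 'rV[int]_d) (x y : 'rV[R]_d) :
  chr m (x - y) = chr m x * (chr m y)^*.
Proof.
rewrite chr_addr /chr; congr (_ * _).
by rewrite dotC dotNl dotC mulrN cisN.
Qed.

Lemma torus_integral_chr_sub (m : 'rV[int]_d) (x : 'rV[R]_d) :
  torus_integral (fun y => chr m (x - y)) = (m == 0)%:R.
Proof.
under eq_fun do rewrite chr_subE.
rewrite torus_integralZ; last by apply: bucC_conj; exact: bucC_chr.
rewrite torus_integral_conj; last exact: bucC_chr.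
rewrite torus_integral_chr; have [->|_] := eqVneq m 0.
  by rewrite chr0 mul1r conjc1.
by rewrite conjc0 mulr0.
Qed.

Lemma chr_delta_sub (x y : 'rV[R]_d) i :
  chr (delta_mx 0 i) (x - y) = cis (2 * pi * (x 0 i - y 0 i)).
Proof.
rewrite /chr /dot (bigD1 i) //= big1.
  by rewrite !mxE !eqxx addr0 mul1r.
by move=> j ji; rewrite !mxE (negPf ji) mul0r.
Qed.

Lemma bucC_fkernel x : bucC (fun y => (fkernel (x - y))%:C).
Proof.
under eq_fun do rewrite fkernelE.
apply: bucCM; first exact: bucC_cst.
by apply: bucC_sum => a; apply: bucC_sum => b; exact: bucC_chr_sub.
Qed.

Lemma buc_fkernel x : buc (fun y => fkernel (x - y)).
Proof. by have [] := bucC_fkernel x. Qed.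

Lemma fkernel_chr_integral (m : 'rV[int]_d) x :
  torus_integral (fun y => chr m (x - y) * (fkernel (x - y))%:C) =
  ((M ^ d)%:R^-1)%:C * \sum_(a : I) \sum_(b : I) (m + (freq a - freq b) == 0)%:R.
Proof.
transitivity (torus_integral (fun y => ((M ^ d)%:R^-1)%:C *
    \sum_(a : I) \sum_(b : I) chr (m + (freq a - freq b)) (x - y))).
  congr torus_integral; apply/funext => y; rewrite fkernelE mulrCA.
  congr (_ * _); rewrite mulr_sumr; apply: eq_bigr => a _.
  by rewrite mulr_sumr; apply: eq_bigr => b _; rewrite -chrD.
rewrite torus_integralZ; last first.
  by apply: bucC_sum => a; apply: bucC_sum => b; exact: bucC_chr_sub.
congr (_ * _); rewrite torus_integral_sum; last first.
  by move=> a; apply: bucC_sum => b; exact: bucC_chr_sub.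
apply: eq_bigr => a _; rewrite torus_integral_sum; last first.
  by move=> b; exact: bucC_chr_sub.
by apply: eq_bigr => b _; rewrite torus_integral_chr_sub.
Qed.

Lemma fkernel_integral x : cube_integral (fun y => fkernel (x - y)) = 1.
Proof.
have := fkernel_chr_integral 0 x.
under eq_fun do rewrite chr0 mul1r.
have -> : \sum_(a : I) \sum_(b : I) (0 + (freq a - freq b) == 0)%:R =
    ((M ^ d)%:R)%:C :> R[i].
  transitivity (\sum_(a : I) (1 : R[i])).
    apply: eq_bigr => a _; rewrite (bigD1 a) // subrr addr0 eqxx big1.
      by rewrite [LHS]addr0.
    move=> b /andP[_ ba]; rewrite add0r subr_eq0 (inj_eq freq_inj) eq_sym.
    by rewrite (negPf ba).
  by rewrite sumr_const card_freq rmorph_nat.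
rewrite -rmorphM mulVf ?gt_eqF ?Md_gt0 // => /(congr1 (@complex.Re R)).
by [].
Qed.

(** This is a first Fourier coefficient of the kernel: a partner [b] with freq b = freq a + e_i
    exists for the (M - 1) M^(d - 1) indices [a] such that [(a i).+1 < M]. *)
Lemma fkernel_cos_integral (x : 'rV[R]_d) (i : 'I_d) :
  1 - M%:R^-1 <= cube_integral (fun y =>
    complex.Re (cis (2 * pi * (x 0 i - y 0 i))) * fkernel (x - y)).
Proof.
have MR : 0 < M%:R :> R by rewrite ltr0n.
pose ei : 'rV[int]_d := delta_mx 0 i.
have chre y := chr_delta_sub x y i.
have := congr1 (@complex.Re R) (fkernel_chr_integral ei x).
rewrite /= => E.
rewrite (_ : (fun y => _) = fun y =>
    complex.Re (chr ei (x - y) * (fkernel (x - y))%:C)); last first.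
  by apply/funext => y; rewrite ReM chre /= mulr0 subr0.
rewrite E ReM /= mul0r subr0 -ler_pdivrMl ?invr_gt0 ?Md_gt0 // invrK.
rewrite Re_sum.
apply: (@le_trans _ _ (\sum_(a : I) ((a i).+1 < M)%:R)).
  (* Writing the indicator as a product over coordinates makes the count factorise. *)
  pose F (j : 'I_d) (v : 'I_M) : R := if j == i then (v.+1 < M)%:R else 1.
  have -> : \sum_(a : I) ((a i).+1 < M)%:R = \sum_(a : I) \prod_j F j (a j).
    apply: eq_bigr => a _; rewrite (bigD1 i) //= big1 ?mulr1.
      by rewrite /F eqxx.
    by move=> j ji; rewrite /F (negPf ji).
  rewrite -bigA_distr_bigA (bigD1 i) //=.
  have -> : \sum_v F i v = M%:R - 1.
    rewrite /F eqxx; case: (M) M0 => // M' _.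
    rewrite big_ord_recr /= ltnn addr0 (eq_bigr (fun=> 1)).
      by rewrite sumr_const card_ord -[M'.+1%:R]natr1 addrK.
    by move=> v _; rewrite /= ltnS ltn_ord.
  rewrite (eq_bigr (fun=> M%:R)); last first.
    move=> j ji; rewrite /F (negPf ji) sumr_const card_ord //.
  rewrite prodr_const cardC1 card_ord natrX.
  have d0 : (0 < d)%N by apply: leq_ltn_trans (ltn_ord i).
  rewrite -[X in M%:R ^+ X](prednK d0) exprS.
  apply: eq_ler; field; apply/eqP; lra.
apply: ler_sum => a _; rewrite Re_sum.
have nn (b : I) : 0 <= complex.Re ((ei + (freq a - freq b) == 0)%:R : R[i]).
  by case: (_ == _) => /=.
have [aM|_] := ltnP (a i).+1 M; last exact: sumr_ge0.
pose b : I := [ffun j => if j == i then Ordinal aM else a j].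
rewrite (bigD1 b) //= (_ : ei + _ == 0); last first.
  rewrite addrA subr_eq0; apply/eqP/rowP => j; rewrite !mxE ffunE /=.
  by case: (eqVneq j i) => [->|_] /=; lia.
by rewrite /= lerDl sumr_ge0.
Qed.

(** Integrate the modulus inequality against the kernel: total mass 1 leaves [e], and each of the
    [d] coordinates costs at most 1 / M by the bound on the first Fourier coefficient. *)
Lemma fkernel_approx (u : 'rV[R]_d -> R) (e C : R) x : buc u -> 0 <= C ->
  (forall x y : 'rV[R]_d, `|u x - u y| <=
    e + C * \sum_i (1 - complex.Re (cis (2 * pi * (x 0 i - y 0 i))))) ->
  `|cube_integral (fun y => u y * fkernel (x - y)) - u x| <=
    e + C * (d%:R / M%:R).
Proof.
move=> bu C0 mod_u; pose k y := fkernel (x - y).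
have bk : buc k by exact: buc_fkernel.
have k0 y : 0 <= k y by rewrite divr_ge0 ?sqr_ge0.
pose s i (y : 'rV[R]_d) : R := 1 - complex.Re (cis (2 * pi * (x 0 i - y 0 i))).
pose ei i : 'rV[int]_d := delta_mx 0 i.
have bs i : buc (s i).
  have [bc _] := bucC_chr_sub (ei i) x.
  have := bucD (@buc_cst R d 1) (bucN bc); congr buc.
  by apply/funext => y; rewrite chr_delta_sub.
pose g y := (e + C * \sum_i s i y) * k y.
have bg : buc g.
  apply: bucM => //; apply: bucD; first exact: buc_cst.
  by apply: bucZ; exact: buc_sum.
have Ig : cube_integral g <= e + C * (d%:R / M%:R).
  have -> : g = fun y => e * k y + C * \sum_i s i y * k y.
    by apply/funext => y; rewrite /g mulrDl -mulrA -mulr_suml.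
  have bsk i : buc (fun y => s i y * k y) by exact: bucM.
  rewrite cube_integralD ?cube_integralZ //; last 3 first.
  - exact: buc_sum.
  - exact: bucZ.
  - by apply: bucZ; exact: buc_sum.
  rewrite fkernel_integral mulr1 lerD2l ler_wpM2l //.
  rewrite cube_integral_sum // mulr_natl -[d in leRHS]card_ord -sumr_const.
  apply: ler_sum => i _.
  have bck : buc (fun y => complex.Re (cis (2 * pi * (x 0 i - y 0 i))) * k y).
    apply: bucM => //; have := bucD (@buc_cst R d 1) (bucN (bs i)).
    by congr buc; apply/funext => y; rewrite /s; ring.
  have -> : (fun y => s i y * k y) = fun y => k y +
      - 1 * (complex.Re (cis (2 * pi * (x 0 i - y 0 i))) * k y).
    by apply/funext => y; rewrite /s; ring.
  rewrite cube_integralD ?cube_integralZ //; last exact: bucZ.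
  rewrite fkernel_integral mulN1r lerBlDr -lerBlDl.
  exact: fkernel_cos_integral.
have buk : buc (fun y => u y * k y) by exact: bucM.
have -> : u x = cube_integral (fun y => u x * k y).
  by rewrite cube_integralZ // fkernel_integral mulr1.
have bxk : buc (fun y => u x * k y) by exact: bucZ.
rewrite ler_distl; apply/andP; split.
  rewrite lerBlDr.
  apply: (@le_trans _ _ (cube_integral (fun y => u y * k y) + cube_integral g)).
    2: by rewrite lerD2l.
  rewrite -cube_integralD //; apply: le_cube_integral => //; first exact: bucD.
  move=> y; rewrite /g -mulrDl ler_wpM2r // -lerBlDl.
  by apply: le_trans (ler_norm _) _; exact: mod_u.
apply: (@le_trans _ _ (cube_integral (fun y => u x * k y) + cube_integral g)).
  2: by rewrite lerD2l.
rewrite -cube_integralD //; apply: le_cube_integral => //; first exact: bucD.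
move=> y; rewrite /g -/(k y) -mulrDl ler_wpM2r // -lerBlDl.
by apply: le_trans (ler_norm _) _; rewrite distrC; exact: mod_u.
Qed.

(** The triangular weights are left as a double sum: for fixed [b] the frequencies [freq a - freq b]
    are distinct, which is the form that the estimates for finite families accept. *)
Definition fejer (f : 'rV[R]_d -> R[i]) (x : 'rV[R]_d) : R[i] :=
  ((M ^ d)%:R^-1)%:C * \sum_(a : I) \sum_(b : I)
    fourier f (freq a - freq b) * chr (freq a - freq b) x.

Lemma fejerE f x : bucC f ->
  fejer f x = torus_integral (fun y => f y * (fkernel (x - y))%:C).
Proof.
move=> bf.
have bfc m : bucC (fun y => f y * chr m (x - y)).
  by apply: bucCM => //; exact: bucC_chr_sub.
transitivity (torus_integral (fun y => ((M ^ d)%:R^-1)%:C *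
    \sum_(a : I) \sum_(b : I) (f y * chr (freq a - freq b) (x - y)))).
  rewrite torus_integralZ; last first.
    by apply: bucC_sum => a; exact: bucC_sum.
  congr (_ * _); rewrite torus_integral_sum; last by move=> a; exact: bucC_sum.
  apply: eq_bigr => a _; rewrite torus_integral_sum //.
  apply: eq_bigr => b _; rewrite fourierE mulrC -torus_integralZ; last first.
    by apply: bucCM => //; apply: bucC_conj; exact: bucC_chr.
  by congr torus_integral; apply/funext => y; rewrite chr_subE mulrCA.
congr torus_integral; apply/funext => y; rewrite fkernelE mulrCA.
congr (_ * _); rewrite mulr_sumr; apply: eq_bigr => a _.
by rewrite mulr_sumr.
Qed.

End Kernel.

Lemma fejer_approx d (f : 'rV[R]_d -> R[i]) e : bucC f -> Defs.periodic f -> 0 < e ->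
  exists2 M : nat, (0 < M)%N & forall x, normc (f x - fejer M f x) <= e.
Proof.
move=> bf pf e0; have [br bi] := bf; have e4 : 0 < e / 4 by lra.
have [|C1 C10 mod1] := periodic_modulus br _ e4; first by move=> x m; rewrite pf.
have [|C2 C20 mod2] := periodic_modulus bi _ e4; first by move=> x m; rewrite pf.
pose C := C1 + C2 + 1; have C0 : 0 < C by rewrite /C; lra.
pose M := (Num.truncn (C * d%:R / (e / 4))).+1.
have MR : 0 < M%:R :> R by rewrite ltr0n.
have CM : C * (d%:R / M%:R) <= e / 4.
  rewrite mulrA ler_pdivrMr // [leRHS]mulrC -ler_pdivrMr //.
  have h0 : 0 <= C * d%:R / (e / 4) by rewrite !mulr_ge0 ?invr_ge0 ?(ltW C0) ?(ltW e4).
  by have /andP[_ /ltW] := truncn_itv h0.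
have dM : 0 <= d%:R / M%:R :> R by rewrite divr_ge0.
exists M => // x; rewrite -normcN opprB fejerE //.
apply: le_trans (normc_le_ReIm _) _.
rewrite ReD ImD !raddfN /=.
have := fkernel_approx (M := M) isT x br C10 mod1.
have := fkernel_approx (M := M) isT x bi C20 mod2.
rewrite (_ : (fun y => complex.Re (f y * (fkernel M (x - y))%:C)) =
  fun y => complex.Re (f y) * fkernel M (x - y)); last first.
  by apply/funext => y; rewrite ReM /= mulr0 subr0.
rewrite (_ : (fun y => complex.Im (f y * (fkernel M (x - y))%:C)) =
  fun y => complex.Im (f y) * fkernel M (x - y)); last first.
  by apply/funext => y; rewrite ImM /= mulr0 add0r.
move=> h1 h2; apply: le_trans (lerD h2 h1) _.
have : C1 * (d%:R / M%:R) <= C * (d%:R / M%:R) by rewrite ler_wpM2r // /C; lra.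
have : C2 * (d%:R / M%:R) <= C * (d%:R / M%:R) by rewrite ler_wpM2r // /C; lra.
by lra.
Qed.

End Fejer.

(** * Separation of the points alpha . m modulo 1 and the resulting sum *)

Section SmallDivisors.
Variable R : realType.
Set Implicit Arguments.
Unset Strict Implicit.
Unset Printing Implicit Defensive.

(** The sup norm with values in [nat], suited to dyadic blocks and to counting in boxes; for d > 0
    it is at most the Euclidean norm and at least that norm divided by [d]. *)
Definition nrm d (m : 'rV[int]_d) : nat := \max_i absz (m 0%R i).

Lemma absz_le_nrm d (m : 'rV[int]_d) i :
  (absz (m 0%R i) <= nrm m)%N.
Proof. exact: (leq_bigmax i). Qed.

Lemma nrm_gt0 d (m : 'rV[int]_d) : m != 0 -> (0 < nrm m)%N.
Proof.
apply: contraNT; rewrite -eqn0Ngt => /eqP m0; apply/eqP/rowP => i.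
by rewrite mxE; apply/eqP; rewrite -absz_eq0 -leqn0; have := absz_le_nrm m i; rewrite m0.
Qed.

Lemma nrmB_le d (m n : 'rV[int]_d) L : (nrm m <= L)%N -> (nrm n <= L)%N ->
  (nrm (m - n) <= 2 * L)%N.
Proof.
move=> mL nL; apply/bigmax_leqP => i _; rewrite !mxE.
have := leq_trans (absz_le_nrm m i) mL; have := leq_trans (absz_le_nrm n i) nL.
by move: (m 0 i) (n 0 i) => x y; lia.
Qed.

Lemma sqr_enorm d (x : 'rV[R]_d) : enorm x ^+ 2 = \sum_i x 0 i ^+ 2.
Proof.
rewrite /enorm sqr_sqrtr /dot; first by apply: eq_bigr => i _; rewrite expr2.
by apply: sumr_ge0 => i _; rewrite -expr2 sqr_ge0.
Qed.

Lemma sqr_zvec d (m : 'rV[int]_d) i :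
  zvec R m 0 i ^+ 2 = (absz (m 0 i))%:R ^+ 2.
Proof. by rewrite mxE natr_absz intr_norm real_normK ?num_real. Qed.

Lemma enorm_zvec_le d (m : 'rV[int]_d) L : (nrm m <= L)%N ->
  enorm (zvec R m) <= d%:R * L%:R.
Proof.
move=> mL; rewrite -ler_sqr ?nnegrE ?sqrtr_ge0 ?mulr_ge0 // sqr_enorm.
apply: (@le_trans _ _ (\sum_(i < d) L%:R ^+ 2)).
  apply: ler_sum => i _; rewrite sqr_zvec lerXn2r ?nnegrE // ler_nat.
  exact: leq_trans (absz_le_nrm m i) mL.
rewrite sumr_const card_ord -[_ *+ d]mulr_natl exprMn ler_wpM2r ?sqr_ge0 //.
by rewrite -natrX ler_nat; case: (d) => // d'; rewrite leq_pmulr.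
Qed.

Lemma nrm_le_enorm d (m : 'rV[int]_d) : (0 < d)%N ->
  (nrm m)%:R ^+ 2 <= enorm (zvec R m) ^+ 2.
Proof.
move=> d0; have [|i0 E] := @bigop.eq_bigmax 'I_d (fun i => absz (m 0 i)).
  by rewrite card_ord.
rewrite /nrm E.
by rewrite sqr_enorm (bigD1 i0) //= -sqr_zvec lerDl sumr_ge0 // => i _;
  rewrite sqr_ge0.
Qed.

Lemma powRN_le (x y p : R) : 0 < x -> x <= y -> 0 <= p ->
  y `^ (- p) <= x `^ (- p).
Proof.
move=> x0 xy p0; have y0 : 0 < y by apply: lt_le_trans xy.
rewrite !powRN lef_pV2 ?posrE ?powR_gt0 //.
by rewrite ge0_ler_powR ?nnegrE ?(ltW x0) ?(ltW y0).
Qed.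

Lemma card_nrm_lt d (T : finType) (mu : T -> 'rV[int]_d) (P : pred T) (L : nat) :
  injective mu -> (forall a, P a -> (nrm (mu a) < L)%N) ->
  (#|P| <= (2 * L) ^ d)%N.
Proof.
move=> mu_inj PL; case: L PL => [|L] PL.
  by rewrite eq_card0 // => a; apply/negP => /PL.
pose g a : {ffun 'I_d -> 'I_(2 * L.+1).-1.+1} :=
  [ffun i => inord (absz (mu a 0 i + L.+1%:Z)%R)].
have <- : #|{ffun 'I_d -> 'I_(2 * L.+1).-1.+1}| = ((2 * L.+1) ^ d)%N.
  by rewrite card_ffun !card_ord prednK.
apply: (@leq_card_in _ _ g) => a b /PL aL /PL bL /ffunP ab.
apply: mu_inj; apply/rowP => i; have := ab i; rewrite !ffunE => /(congr1 val).
have := leq_ltn_trans (absz_le_nrm (mu a) i) aL.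
have := leq_ltn_trans (absz_le_nrm (mu b) i) bL.
move=> h1 h2; rewrite /= !inordK; lia.
Qed.

Lemma dotBr d (x y v : 'rV[R]_d) : dot v (x - y) = dot v x - dot v y.
Proof. by rewrite dotDr [dot v (- y)]dotC dotNl [dot y v]dotC. Qed.

(** [s a] is any real representative of alpha . mu a modulo 1. Uniformity over finite families
    allows [mu] to be each shifted frequency box of a Fejer mean. *)
Lemma small_divisor_sum (d : nat) (delta sigma H : R) (alpha : 'rV[R]_d)
    (k : nat) :
  (0 < d)%N -> d%:R / 2 < delta -> d%:R <= sigma -> 0 < H -> (0 < k)%N ->
  2 * delta / sigma <= k%:R ->
  (forall m : 'rV[int]_d, m != 0 ->
     H * enorm (zvec R m) `^ (- sigma) <= dist_int (dot alpha (zvec R m))) ->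
  exists2 c : R, 0 < c & forall (N : nat) (T : finType)
    (mu : T -> 'rV[int]_d) (n : T -> int) (s : T -> R), (1 <= N)%N ->
    injective mu -> (forall a, s a = dot alpha (zvec R (mu a)) - (n a)%:~R) ->
    \sum_(a | mu a != 0) (1 + enorm (zvec R (mu a)) ^+ 2) `^ (- delta) *
      Num.min 1 (`|N%:R * s a| ^- (2 * k)) <=
    c * (N%:R `^ (- (delta / sigma)) * Y d delta sigma N) ^+ 2.
Proof.
move=> d0 hdelta hsigma H0 k0 hk dio.
have dR : 1 <= d%:R :> R by rewrite ler1n.
have s0 : 0 < sigma by lra.
(* A difference of two frequencies in block [j] has entries at most 2^(j+2), hence Euclidean norm at
   most 4 d 2^j. *)
pose H' := H * (4 * d%:R) `^ (- sigma).
have H'0 : 0 < H' by rewrite mulr_gt0 // powR_gt0 // mulr_gt0 //; lra.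
pose C := 8 / H' + 8 / H' ^+ (2 * k) + 4 ^+ d.
have C1 : 0 < 8 / H' by rewrite divr_gt0.
have C2 : 0 < 8 / H' ^+ (2 * k) by rewrite divr_gt0 // exprn_gt0.
have C3 : 0 < 4 ^+ d :> R by rewrite exprn_gt0.
have C0 : 0 < C by rewrite /C; lra.
have [c c0 Hc] := dyadic_sum d0 hdelta hsigma C0 k0 hk.
exists c => [//|N T mu n s N1 mu_inj sE].
have N0 : 0 < N%:R :> R by rewrite ltr0n.
pose tl a := trunc_log 2 (nrm (mu a)).
pose F a := Num.min 1 (`|N%:R * s a| ^- (2 * k)).
have F0 a : 0 <= F a by rewrite le_min ler01 invr_ge0 exprn_ge0.
have F1 a : F a <= 1 by rewrite ge_min lexx.
pose P j a := (mu a != 0) && (tl a == j).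
pose V j := \sum_(a | P j a) F a.
have tlP j a : P j a -> (2 ^ j <= nrm (mu a) < 2 ^ j.+1)%N.
  by move=> /andP[m0 /eqP <-]; apply: trunc_log_bounds => //; exact: nrm_gt0.
have p2 j : 0 < 2 ^+ j :> R by rewrite exprn_gt0.
pose K := (\max_a tl a).+1.
have KE : \sum_(a | mu a != 0) (1 + enorm (zvec R (mu a)) ^+ 2) `^ (- delta) * F a
    <= \sum_(j < K) (2 ^+ j) `^ (- (2 * delta)) * V j.
  pose p a : 'I_K := inord (tl a).
  have pE a : p a = tl a :> nat by rewrite inordK // ltnS leq_bigmax.
  rewrite (partition_big p xpredT) //=; apply: ler_sum => j _.
  rewrite mulr_sumr (eq_bigl (P j)) => [|a]; last by rewrite /P -pE.
  apply: ler_sum => a /tlP/andP[ja _]; rewrite ler_wpM2r //.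
  have -> : - (2 * delta) = 2 * (- delta) by ring.
  rewrite powRrM powR_mulrn ?(ltW (p2 j)) //.
  apply: powRN_le; [by rewrite exprn_gt0| |by lra].
  apply: le_trans (_ : (nrm (mu a))%:R ^+ 2 <= _).
    by rewrite lerXn2r ?nnegrE ?(ltW (p2 j)) // -natrX ler_nat.
  by apply: le_trans (nrm_le_enorm _ d0) _; rewrite lerDr.
apply: le_trans KE _.
have sep j m : m != 0 -> (nrm m <= 2 ^ j.+2)%N ->
    H' * (2 ^+ j) `^ (- sigma) <= dist_int (dot alpha (zvec R m)).
  move=> m0 mj; apply: le_trans (dio _ m0); rewrite /H' -mulrA ler_pM2l //.
  rewrite -powRM ?mulr_ge0 ?(ltW (p2 j)) //.
  apply: powRN_le; last exact: ltW.
    rewrite lt_neqAle eq_sym sqrtr_ge0 andbT -sqrf_eq0 gt_eqF //.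
    by apply: lt_le_trans (nrm_le_enorm m d0); rewrite exprn_gt0 // ltr0n nrm_gt0.
  apply: le_trans (enorm_zvec_le mj) _.
  by apply: eq_ler; rewrite natrX !exprS; ring.
have q0 j : 0 < N%:R * (H' * (2 ^+ j) `^ (- sigma)).
  by apply: mulr_gt0 => //; apply: mulr_gt0 => //; exact: powR_gt0.
have sepP j a : P j a -> N%:R * (H' * (2 ^+ j) `^ (- sigma)) <= `|N%:R * s a|.
  move=> Pa; rewrite normrM gtr0_norm // ler_pM2l // sE.
  apply: le_trans (dist_int_le _ _); apply: sep; first by case/andP: Pa.
  have /andP[_ /ltnW h] := tlP _ _ Pa; apply: leq_trans h _.
  by rewrite leq_exp2l.
(* The difference of two points represents the same linear form at the nonzero vector [mu a - mu b],
   so the Diophantine hypothesis also controls gaps. *)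
have sepPP j a b : P j a -> P j b -> a != b ->
    N%:R * (H' * (2 ^+ j) `^ (- sigma)) <= `|N%:R * s a - N%:R * s b|.
  move=> Pa Pb ab; rewrite -mulrBr normrM gtr0_norm // ler_pM2l //.
  have -> : s a - s b =
      dot alpha (zvec R (mu a - mu b)) - (n a - n b)%:~R.
    by rewrite zvecD zvecN dotBr rmorphB !sE /=; ring.
  apply: le_trans (dist_int_le _ _); apply: sep.
    by rewrite subr_eq0 (inj_eq mu_inj).
  rewrite expnS; apply: nrmB_le; apply/ltnW.
    by have /andP[] := tlP _ _ Pa.
  by have /andP[] := tlP _ _ Pb.
pose u j := (2 ^+ j) `^ sigma / N%:R.
have u0 j : 0 < u j by rewrite divr_gt0 // powR_gt0.
have qE j : N%:R * (H' * (2 ^+ j) `^ (- sigma)) = H' / u j.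
  by rewrite /u powRN invf_div mulrCA.
apply: (Hc N K V N1) => j.
- have [h _] := sum_separated_pow k0 (q0 j) (@sepP j) (@sepPP j).
  apply: le_trans h _; rewrite qE invf_div -/(u j).
  rewrite (_ : 8 * _ = 8 / H' * u j); last by ring.
  by rewrite ler_pM2r //; rewrite /C; lra.
- have [_ h] := sum_separated_pow k0 (q0 j) (@sepP j) (@sepPP j).
  apply: le_trans h _; rewrite qE expr_div_n invf_div -/(u j).
  rewrite (_ : 8 * _ = 8 / H' ^+ (2 * k) * u j ^+ (2 * k)); last by ring.
  by rewrite ler_pM2r ?exprn_gt0 //; rewrite /C; lra.
(* Cardinality bound: each term is at most 1 and the block lies in a box. *)
apply: (@le_trans _ _ (\sum_(a | P j a) 1)); first exact: ler_sum.
rewrite sumr_const; apply: (@le_trans _ _ (4 ^+ d * (2 ^+ j) ^+ d)).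
  have h := @card_nrm_lt d T mu (P j) (2 ^ j.+1) mu_inj.
  have {}h : (#|P j| <= (2 * 2 ^ j.+1) ^ d)%N.
    by apply: h => a /tlP/andP[].
  rewrite -exprMn; apply: (@le_trans _ _ ((2 * 2 ^ j.+1) ^ d)%:R).
    by rewrite ler_nat.
  by apply: eq_ler; rewrite natrX natrM natrX exprS mulrA -natrM.
by rewrite ler_pM2r ?exprn_gt0 // /C; lra.
Qed.

End SmallDivisors.

(** * The discrepancy estimate *)

Section UpperBound.
Variable R : realType.
Set Implicit Arguments.
Unset Strict Implicit.
Unset Printing Implicit Defensive.

Lemma Y_ge0 d (delta sigma : R) N : (0 < N)%N -> 0 <= Y d delta sigma N.
Proof.
move=> N0; rewrite /Y; case: ifP => _; first exact: powR_ge0.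
case: ifP => _; last exact: powR_ge0.
by rewrite ln_ge0 // lerDl.
Qed.

Lemma sobolev_norm_finite d (delta : R) (f : 'rV[R]_d -> R[i]) (T : finType)
    (mu : T -> 'rV[int]_d) (P : pred T) : injective mu -> sobolev delta f ->
  \sum_(a | P a) ((1 + enorm (zvec R (mu a)) ^+ 2) `^ (delta / 2) *
    normc (fourier f (mu a))) ^+ 2 <= sobolev_norm delta f ^+ 2.
Proof.
move=> mu_inj [_ _ fin_f].
pose F m := (1 + enorm (zvec R m) ^+ 2) `^ delta * normc (fourier f m) ^+ 2.
have FE m : ((1 + enorm (zvec R m) ^+ 2) `^ (delta / 2) *
    normc (fourier f m)) ^+ 2 = F m.
  rewrite exprMn -[(_ `^ _) ^+ 2]powR_mulrn ?powR_ge0 // -powRrM.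
  by rewrite divfK.
have F0 m : 0 <= F m by rewrite mulr_ge0 ?powR_ge0 ?sqr_ge0.
have nn : (0 <= sobolev_sqnorm delta f)%E.
  by apply: esum_ge0 => m _; rewrite lee_fin; exact: F0.
have -> : sobolev_norm delta f ^+ 2 = fine (sobolev_sqnorm delta f).
  by rewrite sqr_sqrtr // fine_ge0.
rewrite -lee_fin fineK ?ge0_fin_numE //.
under eq_bigr do rewrite FE.
pose s := [seq mu a | a <- enum P].
have us : uniq s by rewrite map_inj_uniq ?enum_uniq.
apply: esum_ge; exists [set` s]; first by split; [exact: finite_seq|].
rewrite -fsbig_seq // big_map sumEFin lee_fin.
rewrite -[leRHS]/(\sum_(a <- enum P) F (mu a)) big_enum.
by apply: eq_ler; apply: eq_bigl => a.
Qed.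

Section Assembly.
Variables (d : nat) (alpha : 'rV[R]_d).
Variables (Psi : R -> R[i]) (A k : nat).
Hypothesis Psi0 : forall x, A%:R < `|x| -> Psi x = 0.

(** The window of [tsum_decay], wide enough for the samples of [Psi] and of its first [k]
    differences. *)
Let bandwidth (N : nat) := ((A + k).+1 * N)%N.

Lemma Psi_vanish (N : nat) (n : int) : (0 < N)%N -> (bandwidth N < absz n)%N ->
  Psi (N%:R^-1 * n%:~R) = 0.
Proof.
move=> N0 nK; have NR : 0 < N%:R :> R by rewrite ltr0n.
apply: Psi0; rewrite normrM ger0_norm ?invr_ge0 // mulrC ltr_pdivlMr //.
rewrite -intr_norm -natr_absz -natrM ltr_nat; apply: leq_ltn_trans nK.
by rewrite /bandwidth leq_mul2r; apply/orP; right; lia.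
Qed.

Lemma Phi_sum (N : nat) (g : int -> R[i]) : (0 < N)%N ->
  \sum_(n \in [set: int]) (Phi_of Psi N n * g n) =
  \sum_(i < (2 * bandwidth N).+1) (sample_sum Psi N)^-1 *
     Psi (N%:R^-1 * (i%:R - (bandwidth N)%:R)) * g (cidx (bandwidth N) i).
Proof.
move=> N0; rewrite (@fsum_int _ (fun n => Phi_of Psi N n * g n) (bandwidth N)).
  by apply: eq_bigr => i _; rewrite /Phi_of cidxR.
by move=> n nK; rewrite /Phi_of Psi_vanish // mulr0 mul0r.
Qed.

Definition Phi_hat (N : nat) (t : R) : R[i] :=
  (sample_sum Psi N)^-1 * tsum Psi N (bandwidth N) t.

Lemma Phi_sum_chr (N : nat) (m : 'rV[int]_d) x : (0 < N)%N ->
  \sum_(n \in [set: int]) (Phi_of Psi N n * chr m (x + n%:~R *: alpha)) =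
  chr m x * Phi_hat N (dot alpha (zvec R m)).
Proof.
move=> N0; rewrite Phi_sum // /Phi_hat /tsum !mulr_sumr.
apply: eq_bigr => i _; rewrite chr_addr cidxR.
have -> : chr m ((i%:R - (bandwidth N)%:R) *: alpha) =
    cis (2 * pi * (i%:R - (bandwidth N)%:R) * dot alpha (zvec R m)).
  by rewrite /chr dotZr dotC; congr cis; ring.
by ring.
Qed.

(** [B] may depend on [N]: the lemma serves to replace [f] by a Fejer mean with [N] fixed and an
    arbitrarily small error. *)
Lemma discrepancyB_le (N : nat) (f : 'rV[R]_d -> R[i]) (x : 'rV[R]_d) :
  (0 < N)%N -> exists2 B : R, 0 <= B & forall (g : 'rV[R]_d -> R[i]) e,
   (forall y, normc (f y - g y) <= e) ->
   normc (\sum_(n \in [set: int]) (Phi_of Psi N n * f (x + n%:~R *: alpha)) -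
     \sum_(n \in [set: int]) (Phi_of Psi N n * g (x + n%:~R *: alpha))) <= B * e.
Proof.
move=> N0; pose w (i : nat) := (sample_sum Psi N)^-1 *
     Psi (N%:R^-1 * (i%:R - (bandwidth N)%:R)).
exists (\sum_(i < (2 * bandwidth N).+1) normc (w i)).
  by apply: sumr_ge0 => i _; exact: normc_ge0.
move=> g e fg; rewrite !Phi_sum // -sumrB mulr_suml.
apply: le_trans (ler_normc_sum _ _ _) _; apply: ler_sum => i _.
rewrite -mulrBr Normc.normcM; apply: ler_wpM2l => //; exact: normc_ge0.
Qed.

Variable C1 : R.
Hypothesis C10 : 0 < C1.
Hypothesis PsiC1 : forall N : nat, (1 <= N)%N ->
  C1 * N%:R <= normc (sample_sum Psi N).

Lemma Phi_hat0 (N : nat) : (0 < N)%N -> Phi_hat N 0 = 1.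
Proof.
move=> N0; have S0 : sample_sum Psi N != 0.
  apply/eqP => S0; have := PsiC1 N0; rewrite S0 Normc.normc0 leNgt.
  by rewrite mulr_gt0 // ltr0n.
rewrite /Phi_hat -[RHS](mulVf S0); congr (_ * _).
rewrite /sample_sum (@fsum_int _ (fun n => Psi (N%:R^-1 * n%:~R)) (bandwidth N)).
  by apply: eq_bigr => i _; rewrite mulr0 cis0 mulr1 cidxR.
by move=> n; exact: Psi_vanish.
Qed.

(* The diagonal terms [a = b] of the Fejer sum reproduce the mean of [f]. *)
Lemma discrepancy_fejer (N M : nat) (f : 'rV[R]_d -> R[i]) (x : 'rV[R]_d) :
  (0 < N)%N -> (0 < M)%N ->
  \sum_(n \in [set: int]) (Phi_of Psi N n * fejer M f (x + n%:~R *: alpha)) -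
    torus_integral f =
  ((M ^ d)%:R^-1)%:C * \sum_(b : {ffun 'I_d -> 'I_M})
    \sum_(a : {ffun 'I_d -> 'I_M} | freq a - freq b != 0)
      fourier f (freq a - freq b) * (chr (freq a - freq b) x *
        Phi_hat N (dot alpha (zvec R (freq a - freq b)))).
Proof.
move=> N0 M0; pose c m := fourier f m * (chr m x * Phi_hat N (dot alpha (zvec R m))).
have -> : \sum_(n \in [set: int])
    (Phi_of Psi N n * fejer M f (x + n%:~R *: alpha)) =
    ((M ^ d)%:R^-1)%:C * \sum_(a : {ffun 'I_d -> 'I_M})
      \sum_(b : {ffun 'I_d -> 'I_M}) c (freq a - freq b).
  rewrite Phi_sum // /fejer.
  under eq_bigr do rewrite mulrCA mulr_sumr.
  rewrite -mulr_sumr exchange_big; congr (_ * _); apply: eq_bigr => a _.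
  under eq_bigr do rewrite mulr_sumr.
  rewrite exchange_big; apply: eq_bigr => b _.
  rewrite /c -Phi_sum_chr // Phi_sum // mulr_sumr.
  by apply: eq_bigr => i _; rewrite mulrCA.
rewrite exchange_big /=.
have c0 : c 0 = torus_integral f.
  rewrite /c fourier0 chr0 mul1r zvec0 (_ : dot _ _ = 0) ?Phi_hat0 ?mulr1 //.
  by rewrite /dot big1 // => i _; rewrite mxE mulr0.
have Mn0 : ((M ^ d)%:R)%:C != 0 :> R[i].
  by apply/eqP => /(congr1 (@complex.Re R)) /= /eqP; rewrite gt_eqF ?Md_gt0.
have diag (b : {ffun 'I_d -> 'I_M}) :
    \sum_(a : {ffun 'I_d -> 'I_M}) c (freq a - freq b) = torus_integral f +
    \sum_(a : {ffun 'I_d -> 'I_M} | freq a - freq b != 0) c (freq a - freq b).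
  rewrite (bigD1 b) //= subrr c0; congr (_ + _); apply: eq_bigl => a.
  by rewrite subr_eq0 (inj_eq (@freq_inj _ _)).
under eq_bigr do rewrite diag.
rewrite big_split /= mulrDr sumr_const card_freq.
rewrite -[X in X - _]addrC -addrA [X in _ + X](_ : _ = 0) ?addr0 //.
rewrite -[torus_integral f *+ _]mulr_natl mulrA -(rmorph_nat (real_complex R)).
rewrite -rmorphM /=.
by rewrite mulVf ?gt_eqF ?Md_gt0 // rmorph1 mul1r subrr.
Qed.

End Assembly.

Lemma discrepancy_bound (d : nat) (delta sigma H : R) (alpha : 'rV[R]_d)
    (Psi : R -> R[i]) (C1 : R) :
  (0 < d)%N -> d%:R / 2 < delta -> smoothC Psi -> compactly_supported Psi ->
  0 < C1 -> (forall N : nat, (1 <= N)%N -> C1 * N%:R <= normc (sample_sum Psi N)) ->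
  0 < H -> d%:R <= sigma ->
  (forall m : 'rV[int]_d, m != 0 ->
     H * enorm (zvec R m) `^ (- sigma) <= dist_int (dot alpha (zvec R m))) ->
  exists2 c : R, 0 < c & forall (f : 'rV[R]_d -> R[i]) (N : nat) x,
    sobolev delta f -> (1 <= N)%N ->
    normc (discrepancy (Phi_of Psi) alpha N f x) <=
    c * sobolev_norm delta f * N%:R `^ (- (delta / sigma)) * Y d delta sigma N.
Proof.
move=> d0 hdelta sPsi cPsi C10 PsiC1 H0 hsigma dio.
have [A Psi0] := compact_support_bound cPsi.
(* The order of decay that [dyadic_sum] asks for. *)
pose k := (Num.truncn (2 * delta / sigma)).+1.
have dR : 1 <= d%:R :> R by rewrite ler1n.
have hk : 2 * delta / sigma <= k%:R.
  have h : 0 <= 2 * delta / sigma by rewrite divr_ge0 ?mulr_ge0 //; lra.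
  by have /andP[_ /ltW] := truncn_itv h.
have [c1 c10 Hsum] := small_divisor_sum d0 hdelta hsigma H0 (ltn0Sn _) hk dio.
have [C2 C20 Hdec] := tsum_decay k sPsi Psi0.
pose q := C2 / C1; have q0 : 0 < q by rewrite divr_gt0.
exists (q * Num.sqrt c1); first by rewrite mulr_gt0 // sqrtr_gt0.
move=> f N x sf N1; have N0 : 0 < N%:R :> R by rewrite ltr0n.
pose Z := q * Num.sqrt c1 * (N%:R `^ (- (delta / sigma)) * Y d delta sigma N).
have Y0 := @Y_ge0 d delta sigma N N1.
have Z0 : 0 <= Z.
  by apply: mulr_ge0; apply: mulr_ge0 => //; rewrite ?powR_ge0 ?sqrtr_ge0 // ltW.
have n0 : 0 <= sobolev_norm delta f by exact: sqrtr_ge0.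
have -> : q * Num.sqrt c1 * sobolev_norm delta f * N%:R `^ (- (delta / sigma)) *
  Y d delta sigma N = sobolev_norm delta f * Z by rewrite /Z; ring.
(* Cauchy-Schwarz after splitting 1 into W^(delta/2) and W^(-delta/2); the bound does not see the
   size of [T]. *)
have key (T : finType) (mu : T -> 'rV[int]_d) : injective mu ->
    \sum_(a | mu a != 0) normc (fourier f (mu a)) *
      normc (Phi_hat Psi A k N (dot alpha (zvec R (mu a)))) <=
    sobolev_norm delta f * Z.
  move=> mu_inj; pose W a := 1 + enorm (zvec R (mu a)) ^+ 2.
  have W0 a : 0 < W a by rewrite ltr_pwDl // sqr_ge0.
  pose ph a := normc (Phi_hat Psi A k N (dot alpha (zvec R (mu a)))).
  rewrite (eq_bigr (fun a => (W a `^ (delta / 2) * normc (fourier f (mu a))) *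
      (W a `^ (- (delta / 2)) * ph a))); last first.
    move=> a _; rewrite mulrACA -powRDp // addrN powRr0 mul1r //.
  apply: cauchy_schwarz => //; first exact: sobolev_norm_finite.
  have [n nP] : exists n : T -> int, forall a,
      `|dot alpha (zvec R (mu a)) - (n a)%:~R| <= 2^-1.
    suff /choice[n ?] : forall a, exists n : int,
        `|dot alpha (zvec R (mu a)) - n%:~R| <= 2^-1 by exists n.
    by move=> a; have [n ? _] := nearest_int (dot alpha (zvec R (mu a))); exists n.
  pose s a := dot alpha (zvec R (mu a)) - (n a)%:~R.
  (* The multiplier is at most [q] times min(1, |N s|^(-k)); squaring yields the exponent 2k. *)
  apply: (@le_trans _ _ (\sum_(a | mu a != 0) q ^+ 2 * (W a `^ (- delta) *
      Num.min 1 (`|N%:R * s a| ^- (2 * k))))).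
    apply: ler_sum => a ma.
    have sa : 0 < `|s a|.
      apply: lt_le_trans (dist_int_le _ _); apply: lt_le_trans (dio _ ma).
      rewrite mulr_gt0 // powR_gt0 // lt_neqAle eq_sym sqrtr_ge0 andbT.
      rewrite -sqrf_eq0 gt_eqF //; apply: lt_le_trans (nrm_le_enorm R (mu a) d0).
      by rewrite exprn_gt0 // ltr0n nrm_gt0.
    have [h1 h2] := Hdec N (n a) (s a) N1 (nP a).
    rewrite /s subrK -/(s a) in h1 h2.
    set S := normc _ in h1 h2.
    have phS : ph a * (C1 * N%:R) <= S.
      rewrite /ph /Phi_hat Normc.normcM Normc.normcV mulrAC.
      rewrite ler_piMl ?normc_ge0 // mulrC ler_pdivrMr ?mul1r ?PsiC1 //.
      by apply: lt_le_trans (PsiC1 _ N1); rewrite mulr_gt0.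
    have C1N : 0 < C1 * N%:R by rewrite mulr_gt0.
    have ph0 : 0 <= ph a by exact: normc_ge0.
    have p1 : ph a <= q.
      rewrite /q ler_pdivlMr // -(ler_pM2r N0) -mulrA.
      exact: le_trans phS h1.
    have p2 : ph a * `|N%:R * s a| ^+ k <= q.
      rewrite normrM gtr0_norm // /q ler_pdivlMr // -(ler_pM2r N0).
      apply: le_trans h2; rewrite (_ : _ * N%:R = ph a * (C1 * N%:R) *
        (N%:R * `|s a|) ^+ k); last by ring.
      by rewrite ler_wpM2r // exprn_ge0 // mulr_ge0 // ltW.
    have Ns : 0 < `|N%:R * s a| by rewrite normrM gtr0_norm // mulr_gt0.
    rewrite exprMn -[(_ `^ _) ^+ 2]powR_mulrn ?powR_ge0 // -powRrM.
    rewrite (_ : - (delta / 2) * 2 = - delta); last by field.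
    rewrite [leRHS]mulrCA ler_pM2l ?powR_gt0 // -ler_pdivrMl ?exprn_gt0 // le_min.
    apply/andP; split.
      by rewrite mulrC ler_pdivrMr ?exprn_gt0 // mul1r lerXn2r ?nnegrE ?(ltW q0).
    rewrite mulrC ler_pdivrMr ?exprn_gt0 // mulrC ler_pdivlMr ?exprn_gt0 //.
    rewrite mulnC exprM -exprMn lerXn2r ?nnegrE ?(ltW q0) //.
    by rewrite mulr_ge0 // exprn_ge0.
  rewrite -mulr_sumr; have h := Hsum N T mu n s N1 mu_inj (fun a => erefl).
  apply: le_trans (ler_wpM2l (sqr_ge0 q) h) _; apply: eq_ler.
  by rewrite /Z -[c1 in LHS](sqr_sqrtr (ltW c10)); ring.
apply/ler_addgt0Pr => e e0.
have bf := sobolev_bucC sf; have pf : Defs.periodic f by case: sf.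
have [B B0 HB] := discrepancyB_le alpha k Psi0 f x N1.
have e'0 : 0 < e / (B + 1) by rewrite divr_gt0 //; lra.
have [M M0 fM] := fejer_approx bf pf e'0.
have Be : B * (e / (B + 1)) <= e.
  by rewrite mulrCA ger_pMr // ler_pdivrMr ?mul1r; lra.
rewrite /discrepancy; set X := \sum_(_ \in _) _.
pose X' := \sum_(n \in [set: int])
  (Phi_of Psi N n * fejer M f (x + n%:~R *: alpha)).
have -> : X - torus_integral f = (X' - torus_integral f) + (X - X') by ring.
apply: le_trans (le_normcD _ _) _; apply: lerD; last first.
  by apply: le_trans Be; exact: HB.
rewrite /X' (discrepancy_fejer _ k Psi0 C10 PsiC1) // Normc.normcM normc_real.
rewrite ger0_norm ?invr_ge0 // mulrC ler_pdivrMr ?Md_gt0 //.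
apply: le_trans (ler_normc_sum _ _ _) _.
(* [key] applies for each fixed [b], and the number M^d of such [b] cancels the normalisation of the
   Fejer mean. *)
apply: (@le_trans _ _ (\sum_(b : {ffun 'I_d -> 'I_M}) sobolev_norm delta f * Z)).
  apply: ler_sum => b _; apply: le_trans (ler_normc_sum _ _ _) _.
  apply: le_trans (key _ (fun a => freq a - freq b) _); last first.
    by move=> a a' /addIr; exact: freq_inj.
  by apply: ler_sum => a _; rewrite !Normc.normcM normc_chr mul1r.
by rewrite sumr_const card_freq -[_ *+ _]mulr_natr.
Qed.

End UpperBound.

(** * A function vanishing at all nodes with large mean and small Sobolev norm *)

Section LowerBound.
Variable R : realType.
Set Implicit Arguments.
Unset Strict Implicit.
Unset Printing Implicit Defensive.
Local Notation C := (R[i]).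

Definition ctrmx m n (A : 'M[C]_(m, n)) : 'M[C]_(n, m) := (map_mx conjc A)^T.

Lemma ctrmxE m n (A : 'M[C]_(m, n)) i j : ctrmx A i j = (A j i)^*.
Proof. by rewrite !mxE. Qed.

Lemma ctrmxK m n (A : 'M[C]_(m, n)) : ctrmx (ctrmx A) = A.
Proof. by apply/matrixP => i j; rewrite !ctrmxE conjcK. Qed.

Lemma ctrmx_mul m n p (A : 'M[C]_(m, n)) (B : 'M[C]_(n, p)) :
  ctrmx (A *m B) = ctrmx B *m ctrmx A.
Proof. by rewrite /ctrmx map_mxM trmx_mul. Qed.

Lemma ctrmx0 m n : ctrmx (0 : 'M[C]_(m, n)) = 0.
Proof. by apply/matrixP => i j; rewrite ctrmxE !mxE conjc0. Qed.

Lemma sqr_norm_mx n (v : 'cV[C]_n) :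
  (ctrmx v *m v) 0 0 = (\sum_k normc (v k 0) ^+ 2)%:C.
Proof.
rewrite mxE rmorph_sum; apply: eq_bigr => k _.
by rewrite ctrmxE mulrC [RHS]sqr_normcC.
Qed.

(** Rows are added one at a time: the next must be orthogonal to the [j] rows found and annihilate
    [Z^T], which is j + N < D linear equations. The product with [Z^T] carries no conjugation since
    it evaluates trigonometric polynomials at the nodes. *)
Lemma orthonormal_rows (N D j : nat) (Z : 'M[C]_(N, D)) : (j + N <= D)%N ->
  exists W : 'M[C]_(j, D), W *m ctrmx W = 1%:M /\ W *m Z^T = 0.
Proof.
elim: j => [|j IH] jD.
  by exists 0; split; apply/matrixP => -[].
have [|W [WW WZ]] := IH; first by apply: leq_trans jD; rewrite leq_add2r.
pose B : 'M[C]_(D, j + N) := row_mx (ctrmx W) Z^T.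
have : kermx B != 0.
  rewrite -mxrank_eq0 mxrank_ker -lt0n subn_gt0.
  by apply: leq_ltn_trans (rank_leq_col B) _.
case/rowV0Pn => v /sub_kermxP; rewrite mul_mx_row => vB v0.
have /eq_row_mx[vW vZ] : row_mx (v *m ctrmx W) (v *m Z^T) = row_mx 0 0.
  by rewrite vB row_mx0.
pose S := \sum_k normc (v 0 k) ^+ 2.
have S0 : 0 < S.
  rewrite lt_neqAle sumr_ge0 => [|k _]; last exact: sqr_ge0.
  rewrite andbT eq_sym; apply: contraNN v0 => /eqP S0; apply/eqP/rowP => k.
  have := @psumr_eq0P R _ xpredT (fun k => normc (v 0 k) ^+ 2).
  move=> /(_ (fun k _ => sqr_ge0 _) S0 k isT) /eqP.
  by rewrite sqrf_eq0 => /eqP/Normc.eq0_normc ->; rewrite mxE.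
have vv : v *m ctrmx v = (S%:C)%:M.
  rewrite [LHS]mx11_scalar; congr (_%:M); rewrite mxE rmorph_sum.
  by apply: eq_bigr => k _; rewrite ctrmxE [RHS]sqr_normcC.
pose t : C := (Num.sqrt S)^-1%:C.
have tt : t * t * S%:C = 1.
  rewrite /t -!rmorphM /= -invfM -expr2 sqr_sqrtr ?ltW // mulVf ?gt_eqF //.
pose w := t *: v.
have ctw : ctrmx w = t *: ctrmx v.
  apply/matrixP => i k; rewrite ctrmxE !mxE.
  by rewrite rmorphM; congr (_ * _); exact: conjc_real.
have ww : w *m ctrmx w = 1%:M.
  by rewrite ctw /w -scalemxAl -scalemxAr scalerA vv scale_scalar_mx tt.
have wW : w *m ctrmx W = 0 by rewrite /w -scalemxAl vW scaler0.
have Ww : W *m ctrmx w = 0.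
  by rewrite -[LHS]ctrmxK ctrmx_mul ctrmxK wW ctrmx0.
suff [W1 [h1 h2]] : exists W1 : 'M[C]_(1 + j, D),
    W1 *m ctrmx W1 = 1%:M /\ W1 *m Z^T = 0 by exists W1.
exists (col_mx w W); split; last first.
  by rewrite mul_col_mx WZ /w -scalemxAl vZ scaler0 col_mx0.
have -> : ctrmx (col_mx w W) = row_mx (ctrmx w) (ctrmx W).
  by rewrite /ctrmx map_col_mx tr_col_mx.
rewrite mul_col_row ww wW Ww WW.
by rewrite -scalar_mx_block.
Qed.

(** The rows of [W] being orthonormal, the difference of the two sides is the squared norm of the
    residual [r]. *)
Lemma bessel_mx (j D : nat) (W : 'M[C]_(j, D)) (e : 'cV[C]_D) :
  W *m ctrmx W = 1%:M ->
  \sum_a normc ((W *m e) a 0) ^+ 2 <= \sum_k normc (e k 0) ^+ 2.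
Proof.
move=> WW; pose y := W *m e; pose r := e - ctrmx W *m y.
have cr : ctrmx r = ctrmx e - ctrmx y *m W.
  rewrite /r /ctrmx map_mxB linearB /=; congr (_ - _).
  by rewrite -/(ctrmx (ctrmx W *m y)) ctrmx_mul ctrmxK.
have ey : ctrmx e *m ctrmx W = ctrmx y by rewrite -ctrmx_mul.
have : ctrmx r *m r = ctrmx e *m e - ctrmx y *m y.
  rewrite cr /r mulmxBl !mulmxBr !mulmxA ey -!(mulmxA _ W (ctrmx W)) WW.
  by rewrite !mulmx1 -!(mulmxA _ W e) -/y subrr subr0.
move=> /(congr1 (fun A : 'M[C]_1 => complex.Re (A 0 0))).
rewrite [in RHS]mxE [X in _ = complex.Re (_ + X)]mxE !sqr_norm_mx /= => E.
rewrite -subr_ge0 -E; apply: sumr_ge0 => k _; exact: sqr_ge0.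
Qed.

Lemma buc_continuous d (u : 'rV[R]_d -> R) : buc u -> continuous u.
Proof.
move=> [_ uu] x; apply/(cvgrPdist_le (FF := nbhs_filter x)) => e /uu[h h0 H].
apply/nbhs_ballP; exists h => //= y [_ xy]; apply: H => i.
by have := xy 0 i; rewrite /ball /= => /ltW.
Qed.

Lemma bucC_continuousC d (f : 'rV[R]_d -> C) : bucC f -> continuousC f.
Proof. by move=> [? ?]; split; exact: buc_continuous. Qed.

(** * The test function attached to the nodes *)

Section TestFunction.
Variables (d L N : nat).
Hypothesis L0 : (0 < L)%N.
Variable z : 'I_N -> 'rV[R]_d.

Local Notation I := {ffun 'I_d -> 'I_L}.
Local Notation D := #|{: I}|.

Let mu (k : 'I_D) : 'rV[int]_d := freq (enum_val k).

Let mu_inj : injective mu.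
Proof. by move=> a b /freq_inj/enum_val_inj. Qed.

Let e x : 'cV[C]_D := \col_k chr (mu k) x.

Variables (j : nat) (W : 'M[C]_(j, D)).
Hypothesis WW : W *m ctrmx W = 1%:M.
Hypothesis WZ : forall n, W *m e (z n) = 0.

(** This is the sum of the squared moduli of the entries of [W *m e x], expanded so that its Fourier
    coefficients can be read off. *)
Definition test_fun (x : 'rV[R]_d) : C :=
  \sum_(a < j) \sum_k \sum_l W a k * (W a l)^* * chr (mu k - mu l) x.

Lemma test_funE x : test_fun x = (\sum_a normc ((W *m e x) a 0) ^+ 2)%:C.
Proof.
rewrite rmorph_sum; apply: eq_bigr => a _; rewrite [RHS]sqr_normcC mxE.
rewrite rmorph_sum mulr_suml; apply: eq_bigr => k _.
rewrite mulr_sumr; apply: eq_bigr => l _.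
by rewrite rmorphM !mxE /= chrD chrN; ring.
Qed.

Lemma test_fun_ge0 x : 0 <= \sum_a normc ((W *m e x) a 0) ^+ 2.
Proof. by apply: sumr_ge0 => a _; exact: sqr_ge0. Qed.

(** All characters are unimodular, so [e x] has squared norm [D] at every [x]. *)
Lemma normc_test_fun x : normc (test_fun x) <= D%:R.
Proof.
rewrite test_funE normc_real ger0_norm ?test_fun_ge0 //.
apply: le_trans (bessel_mx _ WW) _.
rewrite (eq_bigr (fun=> 1)) ?sumr_const ?card_ord //.
by move=> k _; rewrite mxE normc_chr expr1n.
Qed.

Lemma test_fun_node n : test_fun (z n) = 0.
Proof.
rewrite test_funE WZ big1 // => a _.
by rewrite mxE Normc.normc0 expr0n.
Qed.

Let bucC_term a k l : bucC (fun x => W a k * (W a l)^* * chr (mu k - mu l) x).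
Proof. by apply: bucCM; [exact: bucC_cst|exact: bucC_chr]. Qed.

Lemma bucC_test_fun : bucC test_fun.
Proof.
by apply: bucC_sum => a; apply: bucC_sum => k; apply: bucC_sum => l.
Qed.

Lemma fourier_test_fun m : fourier test_fun m =
  \sum_(a < j) \sum_k \sum_l W a k * (W a l)^* * (mu k - mu l - m == 0)%:R.
Proof.
have bt a k l : bucC (fun x => W a k * (W a l)^* * chr (mu k - mu l - m) x).
  by apply: bucCM; [exact: bucC_cst|exact: bucC_chr].
rewrite fourierE; transitivity (torus_integral (fun x =>
   \sum_(a < j) \sum_k \sum_l W a k * (W a l)^* * chr (mu k - mu l - m) x)).
  congr torus_integral; apply/funext => x; rewrite /test_fun mulr_suml.
  apply: eq_bigr => a _; rewrite mulr_suml; apply: eq_bigr => k _.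
  rewrite mulr_suml; apply: eq_bigr => l _.
  by rewrite [in RHS]chrD chrN mulrA.
rewrite torus_integral_sum; last first.
  by move=> a; apply: bucC_sum => k; exact: bucC_sum.
apply: eq_bigr => a _; rewrite torus_integral_sum; last first.
  by move=> k; exact: bucC_sum.
apply: eq_bigr => k _; rewrite torus_integral_sum //.
apply: eq_bigr => l _; rewrite torus_integralZ; last exact: bucC_chr.
by rewrite torus_integral_chr.
Qed.

Lemma torus_integral_test_fun : torus_integral test_fun = j%:R.
Proof.
rewrite -fourier0 fourier_test_fun.
have -> : j%:R = \sum_(a < j) (1 : C) by rewrite sumr_const card_ord.
apply: eq_bigr => a _.
transitivity (\sum_k W a k * ctrmx W k a); last first.
  have := congr1 (fun A : 'M[C]_j => A a a) WW.
  by rewrite mxE => ->; rewrite mxE eqxx mulr1n.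
apply: eq_bigr => k _; rewrite (bigD1 k) // subrr subr0 eqxx mulr1 ctrmxE.
rewrite big1 => [|l /andP[_ lk]]; first by rewrite [LHS]addr0.
by rewrite subr0 subr_eq0 (inj_eq mu_inj) eq_sym (negPf lk) mulr0.
Qed.

Lemma fourier_test_fun_eq0 m : (L < nrm m)%N -> fourier test_fun m = 0.
Proof.
move=> Lm; rewrite fourier_test_fun big1 // => a _; rewrite big1 // => k _.
rewrite big1 // => l _; case: eqP => [/eqP|_]; last by rewrite mulr0.
rewrite subr_eq0 => /eqP E; move: Lm; rewrite ltnNge -E => /negP[].
apply/bigmax_leqP => i _; rewrite !mxE.
have := ltn_ord (enum_val k i); have := ltn_ord (enum_val l i).
by move: (enum_val k i : nat) (enum_val l i : nat) => p q; lia.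
Qed.

(** On the frequencies that occur, the weight is at most its value at radius d L; the squared
    coefficients sum to at most D^2 by [bessel] with the sup bound. *)
Lemma sobolev_sqnorm_test_fun delta : 0 <= delta ->
  (sobolev_sqnorm delta test_fun <=
   ((1 + (d%:R * L%:R) ^+ 2) `^ delta * D%:R ^+ 2)%:E)%E.
Proof.
move=> delta0; apply: ub_ereal_sup => _ [X [finX _] <-].
have [s us Xs] : exists2 s : seq 'rV[int]_d, uniq s & X = [set` s].
  have /finite_seqP[s ->] := finX; exists (undup s); first exact: undup_uniq.
  by apply/seteqP; split => x /=; rewrite mem_undup.
rewrite Xs -fsbig_seq // sumEFin lee_fin.
apply: (@le_trans _ _ (\sum_(m <- s) (1 + (d%:R * L%:R) ^+ 2) `^ delta *
    normc (fourier test_fun m) ^+ 2)).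
  apply: ler_sum => m _; have [Lm|mL] := ltnP L (nrm m).
    by rewrite fourier_test_fun_eq0 // Normc.normc0 expr0n !mulr0.
  rewrite ler_wpM2r ?sqr_ge0 // ge0_ler_powR ?nnegrE ?addr_ge0 ?sqr_ge0 //.
  rewrite lerD2l lerXn2r ?nnegrE ?sqrtr_ge0 ?mulr_ge0 //.
  exact: enorm_zvec_le.
rewrite -mulr_sumr ler_wpM2l ?powR_ge0 //.
rewrite (big_nth 0) big_mkord.
apply: (@bessel R d 'I_(size s) (fun i => nth 0 s i)).
- by move=> i i' /eqP; rewrite nth_uniq // => /eqP/ord_inj.
- exact: bucC_test_fun.
- exact: normc_test_fun.
Qed.

Lemma sobolev_test_fun delta : 0 <= delta -> sobolev delta test_fun.
Proof.
move=> delta0; split.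
- exact/bucC_continuousC/bucC_test_fun.
- move=> x m; apply: eq_bigr => a _; apply: eq_bigr => k _.
  by apply: eq_bigr => l _; rewrite chr_addr chr_zvec mulr1.
- exact: le_lt_trans (sobolev_sqnorm_test_fun delta0) (ltry _).
Qed.

Lemma sobolev_norm_test_fun delta : 0 <= delta ->
  sobolev_norm delta test_fun <=
    (1 + (d%:R * L%:R) ^+ 2) `^ (delta / 2) * D%:R.
Proof.
move=> delta0; have h := sobolev_sqnorm_test_fun delta0.
have B0 : 0 <= (1 + (d%:R * L%:R) ^+ 2) `^ (delta / 2) * D%:R :> R.
  by rewrite mulr_ge0 // powR_ge0.
rewrite -ler_sqr ?nnegrE ?sqrtr_ge0 // /sobolev_norm sqr_sqrtr; last first.
  apply: fine_ge0; apply: esum_ge0 => m _.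
  by rewrite lee_fin mulr_ge0 ?powR_ge0 ?sqr_ge0.
rewrite exprMn -[(_ `^ _) ^+ 2]powR_mulrn ?powR_ge0 // -powRrM divfK //.
have [_ _ fin] := sobolev_test_fun delta0.
rewrite -lee_fin fineK // ge0_fin_numE //.
apply: esum_ge0 => m _.
by rewrite lee_fin mulr_ge0 ?powR_ge0 ?sqr_ge0.
Qed.

End TestFunction.

Lemma quadrature_lower_bound (d : nat) (delta : R) : (0 < d)%N -> 0 <= delta ->
  exists2 c : R, 0 < c &
    forall (N : nat) (z : 'I_N -> 'rV[R]_d) (omega : 'I_N -> C), (1 <= N)%N ->
    exists f : 'rV[R]_d -> C,
      [/\ sobolev delta f, ~ (exists k : C, forall x, f x = k) &
          c * N%:R `^ (- (delta / d%:R)) * sobolev_norm delta f <=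
          normc (\sum_(n < N) omega n * f (z n) - torus_integral f)].
Proof.
(* Chosen so that 1 + (d L)^2 <= B t^2 whenever L <= 4 t and t >= 1, with t = N^(1/d). *)
move=> d0 delta0; pose B : R := 1 + (4 * d%:R) ^+ 2.
have B0 : 0 < B by rewrite ltr_pwDl // sqr_ge0.
have dR : 0 < d%:R :> R by rewrite ltr0n.
exists (2^-1 * B `^ (- (delta / 2))); first by rewrite mulr_gt0 ?powR_gt0.
move=> N z omega N1; have NR : 1 <= N%:R :> R by rewrite ler1n.
have N0 : 0 < N%:R :> R by rewrite ltr0n.
pose t : R := N%:R `^ d%:R^-1.
have t1 : 1 <= t by rewrite powR_ge1 // invr_ge0 ltW.
(* K > N^(1/d) gives K^d >= N, doubling gives D = L^d >= 2N, and t >= 1 keeps L at most 4t. *)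
pose K := (Num.truncn t).+1; pose L := (2 * K)%N.
have t0 : 0 <= t by lra.
have /andP[Kt tK] := truncn_itv t0.
have L4 : L%:R <= 4 * t.
  rewrite /L natrM /K -[(_.+1)%:R]natr1; lra.
pose D := #|{: {ffun 'I_d -> 'I_L}}|.
have DE : D = (L ^ d)%N by rewrite /D card_freq.
have NK : (N <= K ^ d)%N.
  rewrite -(ler_nat R) natrX; apply: (@le_trans _ _ (t ^+ d)); last first.
    by rewrite lerXn2r ?nnegrE // ltW.
  rewrite -powR_mulrn // /t -powRrM mulVf ?gt_eqF // powRr1 //.
have ND : (2 * N <= D)%N.
  rewrite DE /L expnMn; apply: leq_mul => //.
  by rewrite -[leqLHS]expn1 leq_exp2l.
pose j := (D - N)%N.
have jN : (j + N <= D)%N by rewrite /j subnK //; lia.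
pose Z : 'M[C]_(N, D) := \matrix_(n, k) chr (freq (enum_val k)) (z n).
have [W [WW WZ]] := orthonormal_rows Z jN.
have L0 : (0 < L)%N by [].
have WZn n : W *m (\col_k chr (freq (enum_val k)) (z n)) = 0.
  have -> : \col_k chr (freq (enum_val k)) (z n) = col n Z^T.
    by apply/colP => k; rewrite !mxE.
  by rewrite colE mulmxA WZ mul0mx.
pose f := test_fun W.
have If : torus_integral f = j%:R by exact: torus_integral_test_fun.
have fz n : f (z n) = 0 by exact: (test_fun_node (z := z)).
have j0 : (0 < j)%N by rewrite /j; lia.
exists f; split.
- exact: sobolev_test_fun.
(* A constant vanishing at a node would have mean 0, whereas the mean is [j], which is positive. *)
- move=> [c fc]; have c0 : c = 0 by rewrite -(fc (z (Ordinal N1))) fz.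
  have : torus_integral f = 0.
    rewrite -[RHS](torus_integral_cst d); congr torus_integral.
    by apply/funext => x; rewrite fc c0.
  by rewrite If => /eqP; rewrite pnatr_eq0 eqn0Ngt j0.
have -> : \sum_(n < N) omega n * f (z n) - torus_integral f = - j%:R.
  by rewrite big1 ?sub0r ?If // => n _; rewrite fz mulr0.
have -> : normc (- j%:R : C) = j%:R.
  by rewrite normcN -(rmorph_nat (real_complex R)) normc_real normr_nat.
have Dj : D%:R <= 2 * j%:R :> R by rewrite -natrM ler_nat /j; lia.
have D0 : 0 <= D%:R :> R by [].
have E : t ^+ 2 = N%:R `^ (2 / d%:R).
  by rewrite -powR_mulrn // /t -powRrM mulrC.
have h : (1 + (d%:R * L%:R) ^+ 2) `^ (delta / 2) <=
    B `^ (delta / 2) * N%:R `^ (delta / d%:R).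
  have -> : N%:R `^ (delta / d%:R) = (t ^+ 2) `^ (delta / 2) :> R.
    by rewrite E -powRrM; congr (_ `^ _); field; apply/eqP; lra.
  rewrite -powRM ?sqr_ge0 ?(ltW B0) // ge0_ler_powR ?nnegrE ?divr_ge0 //.
    by rewrite mulr_ge0 ?sqr_ge0 ?(ltW B0).
  rewrite /B mulrDl mul1r -exprMn lerD ?exprn_ege1 //.
  rewrite lerXn2r ?nnegrE ?mulr_ge0 //.
  by rewrite mulrAC mulrC ler_pM2r // mulrC.
have hn := sobolev_norm_test_fun L0 WW delta0.
apply: (@le_trans _ _ (2^-1 * B `^ (- (delta / 2)) * N%:R `^ (- (delta / d%:R)) *
   (B `^ (delta / 2) * N%:R `^ (delta / d%:R) * D%:R))).
  rewrite ler_wpM2l ?mulr_ge0 ?powR_ge0 ?invr_ge0 //.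
  by apply: le_trans hn _; rewrite ler_wpM2r.
rewrite !powRN; have := powR_gt0 (delta / 2) B0.
have := powR_gt0 (delta / d%:R) N0; move: (_ `^ _) (_ `^ _) => x y y0 x0.
rewrite (_ : _ * (x * y * D%:R) = D%:R / 2); first by lra.
by field; apply/andP; split; apply/eqP; lra.
Qed.

End LowerBound.

Theorem corollary1p11 (R : realType) (d : nat) (delta : R)
    (hd : (1 <= d)%N) (hdelta : d%:R / 2 < delta) :
  (forall (Psi : R -> R[i]) (C1 C2 : R) (alpha : 'rV[R]_d) (H sigma : R),
     smoothC Psi -> compactly_supported Psi -> boundedC Psi ->
     0 < C1 -> 0 < C2 ->
     (forall N : nat, (1 <= N)%N ->
        C1 * N%:R <= normc (sample_sum Psi N) <= C2 * N%:R) ->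
     irrational_vector alpha ->
     0 < H -> d%:R <= sigma ->
     (forall m : 'rV[int]_d, m != 0 ->
        H * enorm (zvec R m) `^ (- sigma) <= dist_int (dot alpha (zvec R m))) ->
     exists2 c : R, 0 < c &
       forall f : 'rV[R]_d -> R[i], sobolev delta f ->
       forall N : nat, (1 <= N)%N ->
         (ereal_sup [set (normc (discrepancy (Phi_of Psi) alpha N f x))%:E
                    | x in [set: 'rV[R]_d]]
          <= (c * sobolev_norm delta f * N%:R `^ (- (delta / sigma))
              * Y d delta sigma N)%:E)%E)
  /\
  (exists2 c : R, 0 < c &
     forall (N : nat) (z : 'I_N -> 'rV[R]_d) (omega : 'I_N -> R[i]),
       (1 <= N)%N ->
       exists f : 'rV[R]_d -> R[i],
         [/\ sobolev delta f,
             ~ (exists k : R[i], forall x, f x = k) &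
             c * N%:R `^ (- (delta / d%:R)) * sobolev_norm delta f <=
             normc (\sum_(n < N) omega n * f (z n) - torus_integral f)]).

Proof.
have d0 : (0 < d)%N by [].
split.
  move=> Psi C1 C2 alpha H sigma sPsi cPsi _ C10 _ PsiC _ H0 hsigma dio.
  have PsiC1 N : (1 <= N)%N -> C1 * N%:R <= normc (sample_sum Psi N).
    by move=> /PsiC /andP[].
  have [c c0 Hc] := discrepancy_bound d0 hdelta sPsi cPsi C10 PsiC1 H0 hsigma dio.
  exists c => // f sf N N1; apply: ub_ereal_sup => _ [x _ <-].
  by rewrite lee_fin; exact: Hc.
apply: quadrature_lower_bound => //.
by apply: le_trans (ltW hdelta); rewrite divr_ge0.
Qed.
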